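(* Let $\mathbb{X}$ and $\mathbb{Y}$ be quantum spaces such that the $\mathrm{C}^*$-algebra $\mathrm{C}(\mathbb{X})$ is finite-dimensional and the $\mathrm{C}^*$-algebra $\mathrm{C}(\mathbb{Y})$ is finitely generated and unital. Then the quantum space of all maps $\mathbb{X}\to\mathbb{Y}$ exists, and it is compact. Explicitly: there exist a unital $\mathrm{C}^*$-algebra $\mathrm{C}(\mathbb{E})$ and a unital $*$-homomorphism $\Phi\colon\mathrm{C}(\mathbb{Y})\to\mathrm{C}(\mathbb{X})\otimes\mathrm{C}(\mathbb{E})$ such that for every unital $\mathrm{C}^*$-algebra $\mathrm{C}(\mathbb{D})$ and every unital $*$-homomorphism $\Psi\colon\mathrm{C}(\mathbb{Y})\to\mathrm{C}(\mathbb{X})\otimes\mathrm{C}(\mathbb{D})$ there exists a unique unital $*$-homomorphism $\Lambda\colon\mathrm{C}(\mathbb{E})\to\mathrm{C}(\mathbb{D})$ satisfying $\Psi=(\mathrm{id}\otimes\Lambda)\circ\Phi$.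
   Context: A quantum space is an object of the category dual to the category of $\mathrm{C}^*$-algebras (over $\mathbb{C}$) with morphisms; the $\mathrm{C}^*$-algebra corresponding to a quantum space $\mathbb{X}$ is denoted $\mathrm{C}_0(\mathbb{X})$. The quantum space $\mathbb{X}$ is called compact if this algebra is unital, and the algebra is then denoted $\mathrm{C}(\mathbb{X})$. All quantum spaces here are compact, so all $\mathrm{C}^*$-algebras are unital and morphisms are unital $*$-homomorphisms. The symbol $\otimes$ denotes the minimal (spatial) tensor product of $\mathrm{C}^*$-algebras. A unital $\mathrm{C}^*$-algebra is called finitely generated if it is a quotient of the full group $\mathrm{C}^*$-algebra $\mathrm{C}^*(\mathbb{F}_n)$ of the free group $\mathbb{F}_n$ on some finite number $n$ of generators. A quantum family of maps $\mathbb{X}\to\mathbb{Y}$ parametrized by $\mathbb{D}$ is a unital $*$-homomorphism $\Psi\colon\mathrm{C}(\mathbb{Y})\to\mathrm{C}(\mathbb{X})\otimes\mathrm{C}(\mathbb{D})$. A quantum family $\Phi\colon\mathrm{C}(\mathbb{Y})\to\mathrm{C}(\mathbb{X})\otimes\mathrm{C}(\mathbb{E})$ is the quantum family of all maps from $\mathbb{X}$ to $\mathbb{Y}$, and $\mathbb{E}$ is the quantum space of all maps from $\mathbb{X}$ to $\mathbb{Y}$, if for any quantum space $\mathbb{D}$ and any quantum family $\Psi\colon\mathrm{C}(\mathbb{Y})\to\mathrm{C}(\mathbb{X})\otimes\mathrm{C}(\mathbb{D})$ there exists a unique unital $*$-homomorphism $\Lambda\colon\mathrm{C}(\mathbb{E})\to\mathrm{C}(\mathbb{D})$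 with $(\mathrm{id}\otimes\Lambda)\circ\Phi=\Psi$. *)

(* Defs.v *)
From HB Require Import structures.
From mathcomp Require Import all_boot all_order all_algebra.
From mathcomp Require Import complex.
From mathcomp Require Import boolp classical_sets reals topology normedtype.

Set Implicit Arguments.
Unset Strict Implicit.
Unset Printing Implicit Defensive.

Import GRing.Theory Num.Theory.
Local Open Scope classical_set_scope.
Local Open Scope ring_scope.

(* Unital C*-algebras. Norms take their values in the nonnegative elements of  *)
(* the scalar field C, which is R[i] in applications. The multiplication is    *)
(* that of a monoidType, written (a * b)%g with unit 1%g, since the hierarchy  *)
(* does not admit a new join of rings and normed modules. The zero algebra is  *)
(* allowed: it is unital, and corresponds to the empty quantum space.          *)
HB.mixin Record isCStarAlgebra (C : numClosedFieldType) A
    of CompleteNormedModule C A & Monoid A := {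
  star : A -> A;
  cstar_mulDl : forall a b c : A, ((a + b) * c)%g = (a * c)%g + (b * c)%g;
  cstar_mulDr : forall a b c : A, (a * (b + c))%g = (a * b)%g + (a * c)%g;
  cstar_scaleAl : forall (z : C) (a b : A), z *: (a * b)%g = ((z *: a) * b)%g;
  cstar_scaleAr : forall (z : C) (a b : A), z *: (a * b)%g = (a * (z *: b))%g;
  cstar_starD : forall a b : A, star (a + b) = star a + star b;
  cstar_starZ : forall (z : C) (a : A), star (z *: a) = z^* *: star a;
  cstar_starM : forall a b : A, star (a * b)%g = (star b * star a)%g;
  cstar_starK : forall a : A, star (star a) = a;
  cstar_normM : forall a b : A, `|(a * b)%g| <= `|a| * `|b|;
  cstar_norm_star : forall a : A, `|(star a * a)%g| = `|a| ^+ 2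
}.

#[short(type="cstarAlgType")]
HB.structure Definition CStarAlgebra (C : numClosedFieldType) :=
  {A of CompleteNormedModule C A & Monoid A & isCStarAlgebra C A}.

(* Unital *-homomorphisms. *)
Definition star_hom (C : numClosedFieldType) (A B : cstarAlgType C)
    (f : A -> B) : Prop :=
  [/\ linear f, {morph f : a b / (a * b)%g}, f 1%g = 1%g
    & {morph f : a / star a}].

(* Complex Hilbert spaces; the inner product is linear on the left. *)
HB.mixin Record isHilbert (C : numClosedFieldType) H
    of CompleteNormedModule C H := {
  dot : H -> H -> C;
  dot_linearl : forall (c : C) (x y z : H),
    dot (c *: x + y) z = c * dot x z + dot y z;
  dot_conj : forall x y : H, dot y x = (dot x y)^*;
  dot_norm : forall x : H, dot x x = `|x| ^+ 2
}.

#[short(type="hilbertType")]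
HB.structure Definition Hilbert (C : numClosedFieldType) :=
  {H of CompleteNormedModule C H & isHilbert C H}.

Section Operators.
Variable C : numClosedFieldType.

(* c is an upper bound of the operator norm of f. *)
Definition opnorm_le (H K : hilbertType C) (f : H -> K) (c : C) : Prop :=
  forall x, `|f x| <= c * `|x|.

(* Unital *-representations A -> B(H). *)
Definition star_rep (A : cstarAlgType C) (H : hilbertType C)
    (pi : A -> H -> H) : Prop :=
  [/\ forall a, linear (pi a) /\ exists c, opnorm_le (pi a) c,
      forall (c : C) a b h, pi (c *: a + b) h = c *: pi a h + pi b h,
      forall a b h, pi (a * b)%g h = pi a (pi b h),
      forall h, pi 1%g h = h
    & forall a h k, dot (pi a h) k = dot h (pi (star a) k)].

(* A realization of A as a C*-algebra of operators on H: the norm of a is the  *)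
(* operator norm of pi a. For a representation of a C*-algebra this is the     *)
(* same as being injective.                                                    *)
Definition faithful_rep (A : cstarAlgType C) (H : hilbertType C)
    (pi : A -> H -> H) : Prop :=
  star_rep pi /\
  forall a (c : C), 0 <= c -> (`|a| <= c <-> opnorm_le (pi a) c).

Definition bilinear_map (U V W : lmodType C) (t : U -> V -> W) : Prop :=
  (forall u, linear (t u)) /\ (forall v, linear (t^~ v)).

(* L, with (h, k) |-> t h k, is the Hilbert space tensor product of H and K. *)
Definition hilbert_tensor (H K L : hilbertType C) (t : H -> K -> L) : Prop :=
  [/\ bilinear_map t,
      forall h k h' k', dot (t h k) (t h' k') = dot h h' * dot k k'
    & dense [set l | exists s : seq (H * K), l = \sum_(p <- s) t p.1 p.2]].

(* T, with (a, b) |-> t a b, is the minimal (spatial) tensor product of A and  *)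
(* B: for realizations of A on H and B on K, T is realized on the Hilbert      *)
(* space tensor product of H and K as the norm closure of the linear span of   *)
(* the operators pi a (x) rho b. Up to isomorphism, T does not depend on the   *)
(* realizations.                                                               *)
Definition min_tensor (A B T : cstarAlgType C) (t : A -> B -> T) : Prop :=
  bilinear_map t /\
  exists (H K L : hilbertType C) (th : H -> K -> L)
         (pi : A -> H -> H) (rho : B -> K -> K) (sigma : T -> L -> L),
    [/\ hilbert_tensor th,
        faithful_rep pi, faithful_rep rho & faithful_rep sigma] /\
    [/\ forall a b h k, sigma (t a b) (th h k) = th (pi a h) (rho b k)
      & dense [set x | exists s : seq (A * B), x = \sum_(p <- s) t p.1 p.2]].

(* h is f (x) g, for the tensor products t and t'. *)
Definition tensor_hom (A B T A' B' T' : cstarAlgType C)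
    (t : A -> B -> T) (t' : A' -> B' -> T')
    (f : A -> A') (g : B -> B') (h : T -> T') : Prop :=
  star_hom h /\ forall a b, h (t a b) = t' (f a) (g b).

Definition finite_dimensional (V : lmodType C) : Prop :=
  exists (n : nat) (e : 'I_n -> V),
    forall v, exists c : 'I_n -> C, v = \sum_(i < n) c i *: e i.

(* G is free on the family x. *)
Definition free_group (n : nat) (G : groupType) (x : 'I_n -> G) : Prop :=
  forall (K : groupType) (y : 'I_n -> K),
    exists! f : G -> K,
      {morph f : g h / (g * h)%g} /\ forall i, f (x i) = y i.

Definition unitary_rep (G : groupType) (H : hilbertType C)
    (V : G -> H -> H) : Prop :=
  [/\ forall g, linear (V g),
      forall g h x, V (g * h)%g x = V g (V h x),
      forall x, V 1%g x = x
    & forall g x y, dot (V g x) (V g y) = dot x y].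

(* A, with g |-> u g, is the full group C*-algebra of the discrete group G:    *)
(* the completion of the group algebra C[G] for the norm                       *)
(*   sup_V || \sum_g c_g V g ||,                                               *)
(* V ranging over the unitary representations of G. A list s of pairs (c, g)   *)
(* stands for an element of C[G].                                              *)
Definition full_group_cstar (G : groupType) (A : cstarAlgType C)
    (u : G -> A) : Prop :=
  [/\ u 1%g = 1%g,
      {morph u : g h / (g * h)%g},
      forall g, u (g^-1)%g = star (u g),
      dense [set a | exists s : seq (C * G), a = \sum_(p <- s) p.1 *: u p.2]
    & forall (s : seq (C * G)) (c : C), 0 <= c ->
        (`|\sum_(p <- s) p.1 *: u p.2| <= c <->
         forall (H : hilbertType C) (V : G -> H -> H), unitary_rep V ->
           opnorm_le (fun x => \sum_(p <- s) p.1 *: V p.2 x) c)].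

Definition finitely_generated (A : cstarAlgType C) : Prop :=
  exists (n : nat) (G : groupType) (x : 'I_n -> G)
         (F : cstarAlgType C) (u : G -> F) (q : F -> A),
    [/\ free_group x, full_group_cstar u, star_hom q
      & forall a, exists b, q b = a].

(* Phi : C(Y) -> T = C(X) (x) C(E) is the quantum family of all maps X -> Y.   *)
(* Tensor products are determined up to isomorphism only, so the universal     *)
(* property ranges over every realization S of C(X) (x) C(D).                  *)
Definition quantum_family_of_all_maps (X Y E T : cstarAlgType C)
    (t : X -> E -> T) (Phi : Y -> T) : Prop :=
  [/\ min_tensor t, star_hom Phi
    & forall (D S : cstarAlgType C) (t' : X -> D -> S) (Psi : Y -> S),
        min_tensor t' -> star_hom Psi ->
        exists! Lambda : E -> D,
          star_hom Lambda /\
          exists idLambda : T -> S,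
            tensor_hom t t' idfun Lambda idLambda /\
            Psi = idLambda \o Phi].

End Operators.

(* Main.v *)
From HB Require Import structures.
Require Import Defs.
From mathcomp Require Import all_boot all_order all_algebra finmap.
From mathcomp Require Import spectral complex ring.
From mathcomp Require Import boolp classical_sets reals topology normedtype.

Set Implicit Arguments.
Unset Strict Implicit.
Unset Printing Implicit Defensive.

Import Order.TTheory GRing.Theory Num.Theory.
Local Open Scope classical_set_scope.
Local Open Scope ring_scope.

(** The algebra of coordinates of a quantum family of maps.

    Fix a basis [e_1, ..., e_n] of [X].  A unital *-homomorphism [Psi] from [Y] to
    [X (x) D] is the same thing as its coordinates [d_i(y)] in [D], determined by
    [Psi(y) = \sum_i e_i (x) d_i(y)] and subject to the algebraic relations which
    say that [Psi] is multiplicative, unital and *-preserving.  The algebra [E] is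
    the universal C*-algebra generated by symbols subject to these relations, and
    it exists because the relations bound the norms of the symbols: in a basis
    coming from the regular representation of [X] on itself, with [u] the
    coordinates of the unit, the operator [Psi(y)] maps [u (x) k] to the vector
    with components [d_i(y) k], and [Psi] is contractive, so that
    [|d_i(y)| <= |u| |y|] ([operator_family_bound]).

    Rather than completing a free *-algebra, [E] is found inside the operators on a
    Hilbert space.  Among all families of operators satisfying the relations one
    selects, for each *-polynomial [q] and each scalar [r], one for which the value
    of [q] is not bounded by [r], if there is any.  This is a set of families, the
    norms are uniformly bounded, and the Hilbert direct sum is a family on which
    every *-polynomial is at least as large as on any other family
    ([universal_operator_family]).  The closure [E] of the *-polynomials in it
    therefore maps to every [D] that carries such coordinates
    ([star_hom_of_dominated]), and [E] comes with a faithful representation, from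
    which [X (x) E] is built ([concrete_min_tensor]).

    Three facts support this.  Unital *-homomorphisms between C*-algebras are
    contractive ([star_hom_contractive]), because a self-adjoint element of norm
    less than 1 is the real part of an isometry.  A finite-dimensional [X] is
    faithfully represented by left multiplication on itself, the inner product
    being [tr (b^* a)] for the trace of the regular representation
    ([trace_form], [regular_rep_isometric]).  Finally, whatever realization of the
    minimal tensor product is chosen, [X (x) D] consists of the sums
    [\sum_i e_i (x) d_i] with unique coefficients ([coef_exists], [coef_unique]),
    hence *-homomorphisms on it are defined on elementary tensors
    ([tensor_extension]). *)

(** * Sequences and completeness *)

(** The order of [C] being partial, nonnegativity is read off the equation
    [w = `|w|], both sides of which are close to [p]. *)
Lemma ge0_approx (C : numFieldType) (w : C) :
  (forall e, 0 < e -> exists2 p, 0 <= p & `|w - p| <= e) -> 0 <= w.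
Proof.
move=> hw; suff -> : w = `|w| by [].
apply/eqP; rewrite -subr_eq0 -normr_le0; apply/ler_addgt0Pr => e e0.
have [p p0 wp] := hw (e / 2) (divr_gt0 e0 (ltr0Sn _ 1)).
rewrite add0r -(subrKA p) (splitr e); apply: le_trans (ler_normD _ _) _.
rewrite lerD// -{1}(ger0_norm p0); apply: le_trans (ler_dist_dist _ _) _.
by rewrite distrC.
Qed.

Section Sequences.
Variables (R : realType).
Local Notation C := R[i].

Lemma ge0_ReK (x : C) : 0 <= x -> (complex.Re x)%:C%C = x.
Proof. by move=> x0; rewrite RRe_real// ger0_real. Qed.

Lemma Re_gt0 (x : C) : 0 < x -> 0 < complex.Re x.
Proof. by move=> x0; rewrite -ltcR ge0_ReK// ltW. Qed.

Lemma exists_invS_le (e : C) : 0 < e -> exists n : nat, n.+1%:R^-1 <= e.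
Proof.
move=> e0; have re0 := Re_gt0 e0.
exists (Num.truncn (complex.Re e)^-1).
rewrite invf_ple ?posrE ?ltr0Sn//.
have h : (complex.Re e)^-1 <= (Num.truncn (complex.Re e)^-1).+1%:R.
  by apply: ltW; apply: truncnS_gt.
move: h; rewrite -lecR => h.
by rewrite -{1}(ge0_ReK (ltW e0)) -fmorphV /= (le_trans h)// rmorph_nat.
Qed.

Lemma exists_expr_le (q e : C) : 0 <= q -> q < 1 -> 0 < e ->
  exists n : nat, q ^+ n <= e.
Proof.
move=> q0 q1 e0; have [->|qn0] := eqVneq q 0.
  by exists 1%N; rewrite expr1 ltW.
have qp : 0 < q by rewrite lt_def qn0.
(* Bernoulli's inequality for q^-1 = 1 + h *)
pose h := q^-1 - 1.
have hp : 0 < h by rewrite subr_gt0 invf_gt1.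
have hE : q^-1 = 1 + h by rewrite /h addrC subrK.
have ber n : 1 + n%:R * h <= q^-1 ^+ n.
  elim: n => [|n IH]; first by rewrite mul0r addr0 expr0.
  rewrite exprS hE in IH *.
  apply: le_trans (ler_wpM2l _ IH); last by rewrite addr_ge0 ?ler01 ?(ltW hp).
  have -> : (1 + h) * (1 + n%:R * h) = 1 + n.+1%:R * h + h * (n%:R * h).
    by rewrite -natr1; ring.
  rewrite lerDl.
  by rewrite !mulr_ge0 ?(ltW hp)// ler0n.
have [n hn] := exists_invS_le (mulr_gt0 e0 hp).
exists n.+1; rewrite -[q]invrK exprVn invf_ple ?posrE ?exprn_gt0 ?invr_gt0//.
apply: le_trans (ber _); rewrite -[e^-1]add0r lerD ?ler01//.
rewrite -ler_pdivrMr//; rewrite invf_ple ?posrE ?ltr0Sn ?mulr_gt0 ?invr_gt0// in hn.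
by rewrite -invfM.
Qed.

Definition cvg_seq (V : normedModType C) (u : nat -> V) (l : V) :=
  forall e : C, 0 < e -> exists N, forall n, (N <= n)%N -> `|u n - l| <= e.

Definition cauchy_seq (V : normedModType C) (u : nat -> V) :=
  forall e : C, 0 < e ->
    exists N, forall m n, (N <= m)%N -> (N <= n)%N -> `|u m - u n| <= e.

Lemma cauchy_seq_cvg (V : completeNormedModType C) (u : nat -> V) :
  cauchy_seq u -> exists l, cvg_seq u l.
Proof.
move=> cu; have : cauchy (u @ \oo).
  apply: cauchy_exP => e e0; have [|N hN] := cu (e / 2); first by rewrite divr_gt0.
  exists (u N), N => // n /= Nn; rewrite -ball_normE /=.
  apply: le_lt_trans (hN _ _ (leqnn N) Nn) _.
  by rewrite ltr_pdivrMr// ltr_pMr// ltr1n.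
move=> /cauchy_cvgP/cvg_ex[l /cvgrPdist_le ul]; exists l => e e0.
have [N _ hN] := ul e e0; exists N => n Nn.
by rewrite distrC; exact: hN.
Qed.

(** The balls of radii [1 / (n + 1)] form a basis of the uniform structure, so a
    Cauchy filter follows any sequence of centers of small balls belonging to it. *)
Lemma cauchy_complete_of_seq (V : normedModType C) :
  (forall u : nat -> V, cauchy_seq u -> exists l, cvg_seq u l) ->
  forall F : set_system V, ProperFilter F -> cauchy F -> cvg F.
Proof.
move=> seqV F FF /cauchyP Fc.
have /choice[u hu] : forall n : nat, exists x, F (ball x (n.+1%:R^-1 : C)).
  by move=> n; apply: Fc; rewrite invr_gt0 ltr0Sn.
have inv2 (e : C) : 0 < e -> exists N, forall n, (N <= n)%N -> n.+1%:R^-1 <= e.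
  move=> e0; have [N hN] := exists_invS_le e0; exists N => n Nn.
  by apply: le_trans hN; rewrite lef_pV2 ?posrE ?ltr0Sn// ler_nat.
have /seqV[l ul] : cauchy_seq u.
  move=> e e0; have e2 : 0 < e / 2 by rewrite divr_gt0.
  have [N hN] := inv2 _ e2; exists N => m n Nm Nn.
  have [z [/= hm hn]] := filter_ex (filterI (hu m) (hu n)).
  rewrite -(subrKA z); apply: le_trans (ler_normD _ _) _.
  rewrite (splitr e) lerD//.
    apply: le_trans (hN _ Nm); apply: ltW.
    by move: hm; rewrite -ball_normE.
  apply: le_trans (hN _ Nn); apply: ltW.
  by move: hn; rewrite -ball_normE /= distrC.
apply/cvg_ex; exists l; apply/cvgrPdist_le => e e0.
have e2 : 0 < e / 2 by rewrite divr_gt0.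
have [N hN] := inv2 _ e2; have [M hM] := ul _ e2.
pose n := maxn N M.
apply: filterS (hu n) => x; rewrite -ball_normE /= => hx.
rewrite distrC -(subrKA (u n)); apply: le_trans (ler_normD _ _) _.
rewrite (splitr e) lerD ?hM ?leq_maxr// distrC.
by apply: le_trans (hN n (leq_maxl _ _)); exact: ltW.
Qed.

Lemma cauchy_seq_sub (V W : normedModType C) (k : C) (u : nat -> V)
    (v : nat -> W) :
  0 <= k -> (forall m n, `|v m - v n| <= k * `|u m - u n|) ->
  cauchy_seq u -> cauchy_seq v.
Proof.
move=> k0 vu cu e e0.
have kp : 0 < k + 1 by rewrite (lt_le_trans ltr01)// lerDr.
have [N hN] := cu (e / (k + 1)) (divr_gt0 e0 kp).
exists N => m n Nm Nn; apply: le_trans (vu m n) _.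
apply: le_trans (ler_wpM2l k0 (hN _ _ Nm Nn)) _.
rewrite mulrCA ler_piMr ?(ltW e0)// ler_pdivrMr// mul1r.
by rewrite lerDl.
Qed.

Lemma cvg_seq_cauchy (V : normedModType C) (u : nat -> V) l :
  cvg_seq u l -> cauchy_seq u.
Proof.
move=> ul e e0; have e2 : 0 < e / 2 by rewrite divr_gt0.
have [N hN] := ul _ e2; exists N => m n Nm Nn.
rewrite -(subrKA l) (splitr e); apply: le_trans (ler_normD _ _) _.
by rewrite lerD ?hN// distrC hN.
Qed.

Lemma cvg_seq_dominated (V W : normedModType C) (k : C) (u : nat -> V) l
    (v : nat -> W) l' :
  0 <= k -> (forall n, `|v n - l'| <= k * `|u n - l|) ->
  cvg_seq u l -> cvg_seq v l'.
Proof.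
move=> k0 vu ul e e0.
have kp : 0 < k + 1 by rewrite (lt_le_trans ltr01)// lerDr.
have [N hN] := ul (e / (k + 1)) (divr_gt0 e0 kp).
exists N => n Nn; apply: le_trans (vu n) _.
apply: le_trans (ler_wpM2l k0 (hN _ Nn)) _.
by rewrite mulrCA ler_piMr ?(ltW e0)// ler_pdivrMr// mul1r lerDl.
Qed.

Lemma cvg_seq_unique (V : normedModType C) (u : nat -> V) l l' :
  cvg_seq u l -> cvg_seq u l' -> l = l'.
Proof.
move=> ul ul'; apply/eqP; rewrite -subr_eq0 -normr_le0.
apply/ler_addgt0Pr => e e0; rewrite add0r.
have e2 : 0 < e / 2 by rewrite divr_gt0.
have [N hN] := ul _ e2; have [M hM] := ul' _ e2.
rewrite -(subrKA (u (maxn N M))); apply: le_trans (ler_normD _ _) _.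
by rewrite (splitr e) lerD ?hM ?leq_maxr// distrC hN ?leq_maxl.
Qed.

Lemma cvg_seq_norm_le (V : normedModType C) (u : nat -> V) l (a : V) (c : C) N :
  cvg_seq u l -> (forall n, (N <= n)%N -> `|u n - a| <= c) -> `|l - a| <= c.
Proof.
move=> ul uc; apply/ler_addgt0Pr => e e0; have [M hM] := ul _ e0.
rewrite -(subrKA (u (maxn N M))) addrC; apply: le_trans (ler_normD _ _) _.
by rewrite lerD ?uc ?leq_maxl// distrC hM ?leq_maxr.
Qed.

Lemma cvg_seq_bounded (V : normedModType C) (u : nat -> V) l (c : C) :
  cvg_seq u l -> (forall n, `|u n| <= c) -> `|l| <= c.
Proof.
move=> ul uc; rewrite -[l]subr0; apply: (@cvg_seq_norm_le _ u _ _ _ 0) => // n _.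
by rewrite subr0.
Qed.

Lemma cvg_seqD (V : normedModType C) (u v : nat -> V) l m :
  cvg_seq u l -> cvg_seq v m -> cvg_seq (fun n => u n + v n) (l + m).
Proof.
move=> ul vm e e0; have e2 : 0 < e / 2 by rewrite divr_gt0.
have [N hN] := ul _ e2; have [M hM] := vm _ e2; exists (maxn N M) => n.
rewrite geq_max => /andP[Nn Mn]; rewrite opprD addrACA (splitr e).
by apply: le_trans (ler_normD _ _) _; rewrite lerD ?hN ?hM.
Qed.

Lemma cvg_seqZD (V : normedModType C) (z : C) (u v : nat -> V) l m :
  cvg_seq u l -> cvg_seq v m -> cvg_seq (fun n => z *: u n + v n) (z *: l + m).
Proof.
move=> ul; apply: cvg_seqD; apply: (cvg_seq_dominated (normr_ge0 z) _ ul) => n.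
by rewrite -scalerBr normrZ.
Qed.

Lemma cvg_seq_cst (V : normedModType C) (l : V) : cvg_seq (fun=> l) l.
Proof. by move=> e e0; exists 0%N => n _; rewrite subrr normr0 ltW. Qed.

Lemma cvg_seq_sum (V : normedModType C) (J : Type) (r : seq J)
    (u : J -> nat -> V) (l : J -> V) :
  (forall j, cvg_seq (u j) (l j)) ->
  cvg_seq (fun n => \sum_(j <- r) u j n) (\sum_(j <- r) l j).
Proof.
move=> ul; elim: r => [|j r IH].
  by under eq_fun do rewrite big_nil; rewrite big_nil; exact: cvg_seq_cst.
rewrite big_cons; under eq_fun do rewrite big_cons.
exact: cvg_seqD.
Qed.

Lemma cvg_seq_sqnorm (V : normedModType C) (u : nat -> V) l :
  cvg_seq u l -> cvg_seq (fun n => `|u n| ^+ 2 : C^o) (`|l| ^+ 2).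
Proof.
move=> ul e e0; have l1 : 0 < 1 + 2 * `|l| by rewrite ltr_pwDl// mulr_ge0.
have [N hN] := ul 1 ltr01; have [M hM] := ul _ (divr_gt0 e0 l1).
exists (maxn N M) => n; rewrite geq_max => /andP[Nn Mn].
rewrite subr_sqr normrM -(divfK (lt0r_neq0 l1) e) ler_pM//.
  by apply: le_trans (ler_dist_dist _ _) (hM n Mn).
rewrite ger0_norm ?addr_ge0// -{1}(subrK l (u n)).
apply: le_trans (lerD (ler_normD _ _) (lexx _)) _.
by rewrite -addrA mulr_natl mulr2n lerD2r hN.
Qed.

Lemma cvg_seq_le (v : nat -> C^o) (s c : C) N :
  cvg_seq v s -> (forall n, (N <= n)%N -> v n <= c :> C) -> s <= c.
Proof.
move=> vs vc; rewrite -subr_ge0; apply: ge0_approx => e /vs[M hM].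
exists (c - v (maxn N M)); first by rewrite subr_ge0 vc// leq_maxl.
by rewrite opprB addrC addrA subrK hM// leq_maxr.
Qed.

Lemma complex_seq_complete (u : nat -> C^o) :
  cauchy_seq u -> exists l, cvg_seq u l.
Proof.
have part (f : {additive C -> R}) : (forall z, `|f z|%:C%C <= `|z|) ->
    cauchy_seq u -> exists l : R,
      forall e : C, 0 < e -> exists N, forall n, (N <= n)%N -> `|f (u n) - l|%:C%C <= e.
  move=> hf cu; have : cauchy ((f \o u : nat -> R^o) @ \oo).
    apply: cauchy_exP => e e0.
    have [|N hN] := cu (e / 2)%:C%C; first by rewrite ltcR divr_gt0.
    exists (f (u N)), N => // n /= Nn; rewrite -ball_normE /=.
    have : `|f (u N) - f (u n)|%:C%C <= (e / 2)%:C%C.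
      by rewrite -raddfB; apply: le_trans (hf _) _; exact: hN.
    rewrite lecR => /le_lt_trans -> //.
    by rewrite ltr_pdivrMr// ltr_pMr// ltr1n.
  move=> /cauchy_cvgP/cvg_ex[l /cvgrPdist_le ul]; exists l => e e0.
  have [N _ hN] := ul _ (Re_gt0 e0); exists N => n Nn.
  by rewrite -(ge0_ReK (ltW e0)) lecR distrC; exact: hN.
move=> cu.
have ni : `|'i%C : C| = 1 by rewrite normc_def /= expr0n expr1n add0r sqrtr1.
have [|a ha] := part (@complex.Re R) _ cu.
  by move=> z; have := normc_ge_Re z.
have [|b hb] := part (@complex.Im R) _ cu.
  move=> z; have := normc_ge_Re (z * 'i%C).
  by rewrite ReiNIm normrN normrM ni mulr1.
exists (a%:C%C + 'i%C * b%:C%C) => e e0.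
have e2 : 0 < e / 2 by rewrite divr_gt0.
have [N hN] := ha _ e2; have [M hM] := hb _ e2.
exists (maxn N M) => n; rewrite geq_max => /andP[Nn Mn].
rewrite [u n]complexE opprD addrACA -mulrBr -!rmorphB /= (splitr e).
apply: le_trans (ler_normD _ _) _; rewrite normrM ni mul1r.
by rewrite !normc_def /= !expr0n !addr0 !sqrtr_sqr lerD ?hN ?hM.
Qed.

End Sequences.

(** * Linear maps and inner products *)

Section LinearMaps.
Variables (K : pzRingType) (U V : lmodType K) (f : U -> V).
Hypothesis fl : linear f.

Lemma linD a b : f (a + b) = f a + f b.
Proof. by rewrite -[a in LHS]scale1r fl scale1r. Qed.

Lemma lin0 : f 0 = 0.
Proof. by apply: (addrI (f 0)); rewrite -linD !addr0. Qed.

Lemma linZ z a : f (z *: a) = z *: f a.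
Proof. by rewrite -[z *: a]addr0 fl lin0 addr0. Qed.

Lemma linB a b : f (a - b) = f a - f b.
Proof. by rewrite linD -scaleN1r linZ scaleN1r. Qed.

Lemma lin_sum (I : Type) (r : seq I) (F : I -> U) :
  f (\sum_(i <- r) F i) = \sum_(i <- r) f (F i).
Proof. by apply: (big_morph f) => [x y|]; rewrite ?linD ?lin0. Qed.

End LinearMaps.

(** Inner products on spaces that carry no norm yet, or another one. *)
Definition inner_form (C : numClosedFieldType) (V : lmodType C)
    (d : V -> V -> C) : Prop :=
  [/\ forall c x y z, d (c *: x + y) z = c * d x z + d y z,
      forall x y, d y x = (d x y)^*,
      forall x, 0 <= d x x
    & forall x, d x x = 0 -> x = 0].

Section InnerForm.
Variables (C : numClosedFieldType) (V : lmodType C) (d : V -> V -> C).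
Hypothesis hd : inner_form d.
Implicit Types x y z : V.

Lemma form_conj x y : d y x = (d x y)^*.
Proof. by case: hd => _ ->. Qed.

Lemma form_ge0 x : 0 <= d x x.
Proof. by case: hd. Qed.

Lemma form_eq0 x : d x x = 0 -> x = 0.
Proof. by case: hd => _ _ _; exact. Qed.

Lemma formDl x y z : d (x + y) z = d x z + d y z.
Proof. by case: hd => dl _ _ _; rewrite -[x in LHS]scale1r dl mul1r. Qed.

Lemma form0l y : d 0 y = 0.
Proof. by apply: (addrI (d 0 y)); rewrite -formDl !addr0. Qed.

Lemma formZl (c : C) x y : d (c *: x) y = c * d x y.
Proof. by case: hd => dl _ _ _; rewrite -[c *: x]addr0 dl form0l addr0. Qed.

Lemma formBl x y z : d (x - y) z = d x z - d y z.
Proof. by rewrite formDl -scaleN1r formZl mulN1r. Qed.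

Lemma formDr x y z : d x (y + z) = d x y + d x z.
Proof. by rewrite form_conj formDl rmorphD /= -!form_conj. Qed.

Lemma formZr (c : C) x y : d x (c *: y) = c^* * d x y.
Proof. by rewrite form_conj formZl rmorphM /= -form_conj. Qed.

Lemma form0r x : d x 0 = 0.
Proof. by rewrite form_conj form0l rmorph0. Qed.

Lemma formBr x y z : d x (y - z) = d x y - d x z.
Proof. by rewrite formDr -scaleN1r formZr rmorphN rmorph1 mulN1r. Qed.

Lemma form_suml (I : Type) (r : seq I) (F : I -> V) y :
  d (\sum_(i <- r) F i) y = \sum_(i <- r) d (F i) y.
Proof.
by apply: (big_morph (fun x => d x y)) => [a b|]; rewrite ?formDl ?form0l.
Qed.

Lemma form_sumr (I : Type) (r : seq I) (F : I -> V) x :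
  d x (\sum_(i <- r) F i) = \sum_(i <- r) d x (F i).
Proof.
by apply: (big_morph (fun y => d x y)) => [a b|]; rewrite ?formDr ?form0r.
Qed.

Lemma form_extl x y : (forall z, d x z = d y z) -> x = y.
Proof.
move=> xy; apply/eqP; rewrite -subr_eq0; apply/eqP/form_eq0.
by rewrite formBl xy subrr.
Qed.

Lemma form_cauchy_schwarz x y : `|d x y| <= sqrtC (d x x) * sqrtC (d y y).
Proof.
have [->|y0] := eqVneq y 0; first by rewrite !form0r normr0 sqrtC0 mulr0.
(* Expand the square of N x - c y, for N = d y y and c = d x y. *)
pose N : C := d y y; pose c := d x y.
have ny : 0 < N.
  by rewrite lt_def form_ge0 andbT; apply: contra_neq y0; exact: form_eq0.
have Nc : N^* = N by apply/CrealP/ger0_real/ltW.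
have := form_ge0 (N *: x - c *: y).
rewrite formBl !formBr !formZl !formZr (form_conj x y) -/N -/c Nc.
have -> : N * (N * d x x) - N * (c^* * c) - (c * (N * c^*) - c * (c^* * N))
          = N * (N * d x x - c * c^*) by ring.
rewrite pmulr_rge0// subr_ge0 -normCK mulrC -(sqrtCK (d x x)) -(sqrtCK N) -exprMn.
rewrite ler_pXn2r// ?nnegrE ?mulr_ge0 ?sqrtC_ge0 ?form_ge0//.
by rewrite !sqrtCK.
Qed.

Definition form_norm x := sqrtC (d x x).

Lemma form_norm_ge0 x : 0 <= form_norm x.
Proof. by rewrite sqrtC_ge0 form_ge0. Qed.

Lemma form_normD x y : form_norm (x + y) <= form_norm x + form_norm y.
Proof.
rewrite -(@ler_pXn2r _ 2) ?nnegrE ?addr_ge0 ?form_norm_ge0//.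
rewrite sqrtCK -[X in X <= _]ger0_norm ?form_ge0// formDl !formDr.
apply: le_trans (ler_normD _ _) _.
apply: le_trans (lerD (ler_normD _ _) (ler_normD _ _)) _.
have -> : (form_norm x + form_norm y) ^+ 2 =
   (form_norm x * form_norm x + form_norm x * form_norm y) +
   (form_norm y * form_norm x + form_norm y * form_norm y) by ring.
by rewrite !lerD ?form_cauchy_schwarz.
Qed.

Lemma form_normZ (c : C) x : form_norm (c *: x) = `|c| * form_norm x.
Proof.
rewrite /form_norm formZl formZr mulrA -normCK sqrtCM ?nnegrE ?exprn_ge0 ?form_ge0//.
by rewrite sqrCK.
Qed.

Lemma form_norm_eq0 x : form_norm x = 0 -> x = 0.
Proof. by move=> /eqP; rewrite sqrtC_eq0 => /eqP/form_eq0. Qed.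

End InnerForm.

(** * Hilbert spaces *)

Section HilbertTheory.
Variables (C : numClosedFieldType) (H : hilbertType C).
Implicit Types x y z : H.

Lemma dot_inner_form : inner_form (@dot C H).
Proof.
split=> [c x y z|x y|x|x]; rewrite ?dot_linearl ?dot_norm ?exprn_ge0//.
  by rewrite dot_conj.
by move/eqP; rewrite sqrf_eq0 normr_eq0 => /eqP.
Qed.

Definition dotDl := formDl dot_inner_form.
Definition dot0l := form0l dot_inner_form.
Definition dotZl := formZl dot_inner_form.
Definition dotBl := formBl dot_inner_form.
Definition dotDr := formDr dot_inner_form.
Definition dotZr := formZr dot_inner_form.
Definition dot0r := form0r dot_inner_form.
Definition dotBr := formBr dot_inner_form.
Definition dot_extl := form_extl dot_inner_form.

Lemma cauchy_schwarz x y : `|dot x y| <= `|x| * `|y|.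
Proof.
have := form_cauchy_schwarz dot_inner_form x y.
by rewrite !dot_norm !sqrCK.
Qed.

Lemma norm_le_of_dot x (c : C) :
  0 <= c -> (forall y, `|dot x y| <= c * `|y|) -> `|x| <= c.
Proof.
move=> c0 hx; have := hx x; rewrite dot_norm normrX normr_id expr2.
by have [->|x0] := eqVneq x 0; rewrite ?normr0// ler_pM2r// normr_gt0.
Qed.

End HilbertTheory.

(** * C*-algebras *)

Lemma dense_normP (K : numFieldType) (V : normedModType K) (S : set V) :
  (forall (x : V) (e : K), 0 < e -> exists2 s, S s & `|x - s| <= e) <-> dense S.
Proof.
split=> [hS O [x Ox] oO|dS x e e0].
  have /nbhs_ballP[e /= e0 he] : nbhs x O by apply: open_nbhs_nbhs.
  have [s Ss xs] := hS x (e / 2) (divr_gt0 e0 (ltr0Sn _ 1)).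
  exists s; split=> //; apply: he; rewrite -ball_normE /=.
  by apply: le_lt_trans xs _; rewrite ltr_pdivrMr ?ltr0Sn// ltr_pMr// ltr1n.
have [|s [xs Ss]] := dS (ball x e) _ (ball_open _ _).
  by exists x; exact: ballxx.
by exists s => //; move: xs; rewrite -ball_normE /= => /ltW.
Qed.

Section CStarTheory.
Variables (C : numClosedFieldType) (A : cstarAlgType C).
Implicit Types a b : A.

Lemma cstar_mul0l a : (0 * a)%g = 0 :> A.
Proof. by apply: (addrI (0 * a)%g); rewrite -cstar_mulDl !addr0. Qed.

Lemma cstar_mul0r a : (a * 0)%g = 0 :> A.
Proof. by apply: (addrI (a * 0)%g); rewrite -cstar_mulDr !addr0. Qed.

Lemma cstar_mulNl a b : (- a * b)%g = - (a * b)%g.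
Proof. by rewrite -scaleN1r -cstar_scaleAl scaleN1r. Qed.

Lemma cstar_mulNr a b : (a * - b)%g = - (a * b)%g.
Proof. by rewrite -scaleN1r -cstar_scaleAr scaleN1r. Qed.

Lemma cstar_mulBl a b c : ((a - b) * c)%g = (a * c)%g - (b * c)%g.
Proof. by rewrite cstar_mulDl cstar_mulNl. Qed.

Lemma cstar_mulBr a b c : (a * (b - c))%g = (a * b)%g - (a * c)%g.
Proof. by rewrite cstar_mulDr cstar_mulNr. Qed.

Lemma cstar_mul_suml (I : Type) (r : seq I) (F : I -> A) b :
  ((\sum_(i <- r) F i) * b)%g = \sum_(i <- r) (F i * b)%g.
Proof.
by apply: (big_morph (fun x => (x * b)%g)) => [x y|];
  rewrite ?cstar_mulDl ?cstar_mul0l.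
Qed.

Lemma cstar_mul_sumr (I : Type) (r : seq I) (F : I -> A) b :
  (b * (\sum_(i <- r) F i))%g = \sum_(i <- r) (b * F i)%g.
Proof.
by apply: (big_morph (fun x => (b * x)%g)) => [x y|];
  rewrite ?cstar_mulDr ?cstar_mul0r.
Qed.

Lemma star0 : star (0 : A) = 0.
Proof. by apply: (addrI (star 0)); rewrite -cstar_starD !addr0. Qed.

Lemma starN a : star (- a) = - star a.
Proof. by rewrite -scaleN1r cstar_starZ rmorphN rmorph1 scaleN1r. Qed.

Lemma starB a b : star (a - b) = star a - star b.
Proof. by rewrite cstar_starD starN. Qed.

Lemma star_sum (I : Type) (r : seq I) (F : I -> A) :
  star (\sum_(i <- r) F i) = \sum_(i <- r) star (F i).
Proof.
by apply: (big_morph (@star C A)) => [x y|]; rewrite ?cstar_starD ?star0.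
Qed.

Lemma star1 : star (1%g : A) = 1%g.
Proof.
have := cstar_starM (star (1%g : A)) 1%g.
by rewrite mulg1 cstar_starK mulg1 => <-.
Qed.

Lemma norm_star a : `|star a| = `|a|.
Proof.
suff le b : `|b| <= `|star b|.
  by apply/eqP; rewrite eq_le le andbT -{2}[a]cstar_starK le.
have [->|b0] := eqVneq b 0; first by rewrite normr0.
have := cstar_normM (star b) b; rewrite cstar_norm_star expr2.
by rewrite ler_pM2r// normr_gt0.
Qed.

Lemma norm1_le1 : `|1%g : A| <= 1.
Proof.
have := cstar_norm_star (1%g : A); rewrite star1 mul1g.
have [->|n0] := eqVneq (1%g : A) 0; first by rewrite normr0 ler01.
rewrite expr2 -{1}[ `|_|]mulr1 => /mulfI -> //.
by rewrite normr_eq0.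
Qed.

Lemma isometry_norm_le1 a : (star a * a)%g = 1%g -> `|a| <= 1.
Proof.
move=> a1; have := cstar_norm_star a; rewrite a1 => na.
have : `|a| ^+ 2 <= 1 by rewrite -na norm1_le1.
by rewrite expr_le1.
Qed.

End CStarTheory.

(** * Unital *-homomorphisms are contractive *)

Section StarHomTheory.
Variables (C : numClosedFieldType) (A B : cstarAlgType C) (f : A -> B).
Hypothesis hf : star_hom f.

Let f_linear : linear f. Proof. by case: hf. Qed.

Definition star_homZD := f_linear.
Definition star_homD := linD f_linear.
Definition star_homZ := linZ f_linear.
Definition star_homB := linB f_linear.
Definition star_hom_sum := lin_sum f_linear.

Lemma star_homM a b : f (a * b)%g = (f a * f b)%g.
Proof. by case: hf => _ ->. Qed.

Lemma star_hom1 : f 1%g = 1%g.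
Proof. by case: hf. Qed.

Lemma star_hom_star a : f (star a) = star (f a).
Proof. by case: hf => _ _ _ ->. Qed.

End StarHomTheory.

Lemma iter_sq_star (C : numClosedFieldType) (A : cstarAlgType C) n (x : A) :
  star x = x -> star (iter n (fun y => y * y)%g x) = iter n (fun y => y * y)%g x.
Proof. by move=> sx; elim: n => //= n IH; rewrite cstar_starM IH. Qed.

Lemma norm_iter_sq (C : numClosedFieldType) (A : cstarAlgType C) n (x : A) :
  star x = x -> `|iter n (fun y => y * y)%g x| = `|x| ^+ (2 ^ n).
Proof.
move=> sx; elim: n => [|n IH]; first by rewrite expn0 expr1.
by rewrite /= -{1}(iter_sq_star n sx) cstar_norm_star IH -exprM expnSr.
Qed.

Section Contractive.
Variables (R : realType).
Local Notation C := R[i].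

Section Limits.
Variable A : cstarAlgType C.

Lemma cvg_seqMl (u : nat -> A) l a : cvg_seq u l -> cvg_seq (fun n => a * u n)%g (a * l)%g.
Proof.
apply: (cvg_seq_dominated (normr_ge0 a)) => n.
by rewrite -cstar_mulBr cstar_normM.
Qed.

Lemma cvg_seq_star (u : nat -> A) l : cvg_seq u l -> cvg_seq (fun n => star (u n)) (star l).
Proof.
move=> ul e e0; have [N hN] := ul e e0; exists N => n Nn.
by rewrite -starB norm_star hN.
Qed.

Lemma cvg_seqMr (u : nat -> A) l a : cvg_seq u l -> cvg_seq (fun n => u n * a)%g (l * a)%g.
Proof.
move=> /cvg_seq_star/(cvg_seqMl (star a))/cvg_seq_star.
rewrite cstar_starM !cstar_starK => h e e0; have [N hN] := h e e0.
by exists N => n /hN; rewrite cstar_starM !cstar_starK.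
Qed.

Lemma cvg_seq_shift (u : nat -> A) l : cvg_seq u l -> cvg_seq (fun n => u n.+1) l.
Proof.
by move=> ul e e0; have [N hN] := ul e e0; exists N => n Nn; apply: hN; exact: leqW.
Qed.

(** The Taylor series of the square root is replaced by the fixed point [b] of
    [x |-> (a^2 + x^2) / 2], a contraction of the ball of radius [|a|]: then
    [(1 - b)^2 = 1 - a^2]. All the iterates, hence [b], are self-adjoint and
    commute with [a]. *)
Lemma sqrt_one_minus_square (a : A) : star a = a -> `|a| < 1 ->
  exists s : A, [/\ star s = s, (a * s)%g = (s * a)%g
                  & (s * s)%g = 1%g - (a * a)%g].
Proof.
move=> sa a1; set q := `|a|; have q0 : 0 <= q by exact: normr_ge0.
pose F (x : A) : A := 2^-1 *: ((a * a)%g + (x * x)%g).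
have F_ball x : `|x| <= q -> `|F x| <= q.
  move=> xq; rewrite normrZ ger0_norm ?invr_ge0 ?ler0n//.
  rewrite ler_pdivrMl ?ltr0Sn//; apply: le_trans (ler_normD _ _) _.
  rewrite mulr_natl mulr2n lerD//.
    by apply: le_trans (cstar_normM _ _) _; rewrite ler_piMr// ltW.
  apply: le_trans (cstar_normM _ _) _.
  by apply: (le_trans (ler_pM _ _ xq xq)) => //; rewrite ler_piMr// ltW.
have F_contr x y : `|x| <= q -> `|y| <= q -> `|F x - F y| <= q * `|x - y|.
  move=> xq yq; rewrite -scalerBr normrZ ger0_norm ?invr_ge0 ?ler0n//.
  rewrite opprD addrACA subrr add0r ler_pdivrMl ?ltr0Sn//.
  have -> : (x * x)%g - (y * y)%g = (x * (x - y))%g + ((x - y) * y)%g.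
    by rewrite cstar_mulBr cstar_mulBl addrA subrK.
  apply: le_trans (ler_normD _ _) _.
  have -> : 2 * (q * `|x - y|) = q * `|x - y| + `|x - y| * q by ring.
  rewrite lerD//; apply: le_trans (cstar_normM _ _) _.
    by rewrite ler_wpM2r.
  by rewrite ler_wpM2l.
pose b n := iter n F 0.
have b_ball n : `|b n| <= q by elim: n => [|n IH]; rewrite ?normr0//; exact: F_ball.
have b_cauchy n m : `|b (n + m)%N - b n| <= q ^+ n.
  elim: n m => [|n IH] m.
    by rewrite expr0 subr0; apply: le_trans (b_ball _) (ltW a1).
  apply: le_trans (F_contr _ _ (b_ball _) (b_ball _)) _.
  by rewrite exprS ler_wpM2l.
have [l bl] : exists l, cvg_seq b l.
  apply: cauchy_seq_cvg => e e0; have e2 : 0 < e / 2 by rewrite divr_gt0.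
  have [N hN] := exists_expr_le q0 a1 e2; exists N => m n Nm Nn.
  rewrite -(subrKA (b N)) (splitr e); apply: le_trans (ler_normD _ _) _.
  rewrite -(subnKC Nm) -(subnKC Nn) [X in _ + X]distrC.
  by rewrite lerD// (le_trans (b_cauchy _ _)).
have cvg_const (x y : A) : cvg_seq (fun=> x) y -> x = y.
  by apply: cvg_seq_unique; exact: cvg_seq_cst.
have lq : `|l| <= q by exact: cvg_seq_bounded bl b_ball.
have Fl : F l = l.
  apply: (@cvg_seq_unique _ _ (fun n => b n.+1)); last exact: cvg_seq_shift.
  move=> e e0; have [N hN] := bl e e0; exists N => n Nn.
  apply: le_trans (F_contr _ _ (b_ball _) lq) _.
  by apply: le_trans (hN n Nn); rewrite ler_piMl// ltW.
have sl : star l = l.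
  apply: (@cvg_seq_unique _ _ (fun n => star (b n))); first exact: cvg_seq_star.
  suff : forall n, star (b n) = b n by move=> /funext ->.
  elim=> [|n IH]; first exact: star0.
  rewrite /= cstar_starZ cstar_starD !cstar_starM sa IH.
  by rewrite fmorphV rmorph_nat.
have al : (a * l)%g = (l * a)%g.
  apply: (@cvg_seq_unique _ _ (fun n => a * b n)%g); first exact: cvg_seqMl.
  suff : forall n, (a * b n)%g = (b n * a)%g.
    by move=> /funext ->; exact: cvg_seqMr.
  elim=> [|n IH]; first by rewrite cstar_mul0l cstar_mul0r.
  rewrite /= -cstar_scaleAl -cstar_scaleAr cstar_mulDl cstar_mulDr !mulgA IH.
  by rewrite -[in LHS](mulgA (b n)) IH mulgA.
exists (1%g - l); split.
- by rewrite starB star1 sl.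
- by rewrite cstar_mulBr cstar_mulBl mulg1 mul1g al.
rewrite cstar_mulBr !cstar_mulBl mulg1 !mul1g mulg1.
have : 2 *: l = (a * a)%g + (l * l)%g.
  by rewrite -[l in LHS]Fl scalerA mulfV ?scale1r// pnatr_eq0.
rewrite scaler_nat mulr2n => ll.
have -> : (a * a)%g = l + l - (l * l)%g by rewrite ll addrK.
by rewrite !opprB opprD -addrA [- l + _]addrCA.
Qed.

End Limits.

(** A self-adjoint [a] with [|a| < 1] is the real part of the isometry
    [a + i s], [s^2 = 1 - a^2], whose image is again an isometry and therefore
    has norm at most 1. *)
Lemma star_hom_contractive (A B : cstarAlgType C) (f : A -> B) :
  star_hom f -> forall a, `|f a| <= `|a|.
Proof.
move=> hf.
have step1 a : star a = a -> `|a| < 1 -> `|f a| <= 1.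
  move=> sa a1; have [s [ss as_ s2]] := sqrt_one_minus_square sa a1.
  pose u := a + 'i *: s.
  have us : star u = a - 'i *: s.
    by rewrite cstar_starD cstar_starZ sa ss conjCi scaleNr.
  have uu : (star u * u)%g = 1%g.
    rewrite us cstar_mulBl !cstar_mulDr -!cstar_scaleAr -!cstar_scaleAl.
    rewrite scalerA -expr2 sqrCi scaleN1r as_ s2 opprD opprK.
    by rewrite addrA addrK addrC subrK.
  have fu : `|f u| <= 1.
    by apply: isometry_norm_le1; rewrite -(star_hom_star hf) -(star_homM hf) uu star_hom1.
  have -> : a = 2^-1 *: (u + star u).
    rewrite us addrACA subrr addr0 -[a in RHS]scale1r -scalerDl scalerA.
    by rewrite mulVf ?scale1r// pnatr_eq0.
  rewrite (star_homZ hf) (star_homD hf) (star_hom_star hf) normrZ.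
  rewrite ger0_norm ?invr_ge0 ?ler0n// ler_pdivrMl ?ltr0Sn// mulr1.
  by apply: le_trans (ler_normD _ _) _; rewrite norm_star -[2]/(1 + 1) lerD.
have step2 a : star a = a -> `|f a| <= `|a|.
  move=> sa; apply/ler_addgt0Pr => e e0.
  have r0 : 0 < `|a| + e by rewrite ltr_wpDl.
  have rc : ((`|a| + e)^-1)^* = (`|a| + e)^-1.
    by apply/CrealP/ger0_real; rewrite invr_ge0 ltW.
  have := step1 ((`|a| + e)^-1 *: a); rewrite cstar_starZ rc sa => /(_ erefl).
  rewrite (star_homZ hf) !normrZ ger0_norm ?invr_ge0 ?(ltW r0)//.
  rewrite ltr_pdivrMl// mulr1 ltrDl => /(_ e0).
  by rewrite ler_pdivrMl// mulr1.
move=> a; have := step2 (star a * a)%g.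
rewrite cstar_starM cstar_starK => /(_ erefl).
rewrite (star_homM hf) (star_hom_star hf) !cstar_norm_star.
by rewrite ler_pXn2r ?nnegrE.
Qed.

(** For a self-adjoint [h] and [m = 2^n] the C*-identity gives [|h^m| = |h|^m], and
    [|h|^m <= k |f h|^m] for all such [m] leaves no room for [|f h| < |h|]. *)
Lemma star_hom_isometric (A B : cstarAlgType C) (f : A -> B) (k : C) :
  star_hom f -> (forall a, `|a| <= k * `|f a|) -> forall a, `|f a| = `|a|.
Proof.
move=> hf fk.
pose sq n (x : A) := iter n (fun y => y * y)%g x.
have normfsq n x : `|f (sq n x)| <= `|f x| ^+ (2 ^ n).
  elim: n => [|n IH]; first by rewrite expn0 expr1.
  rewrite /= (star_homM hf); apply: le_trans (cstar_normM _ _) _.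
  by rewrite expnSr exprM expr2 ler_pM.
have self x : star x = x -> `|x| <= `|f x|.
  move=> sx; have [x0|xn0] := eqVneq `|x| 0; first by rewrite x0.
  have xp : 0 < `|x| by rewrite lt_def xn0 normr_ge0.
  have kp : 0 < k.
    have := lt_le_trans xp (fk x); rewrite pmulr_lgt0//.
    rewrite lt_def normr_ge0 andbT; apply/eqP => fx0.
    by have := lt_le_trans xp (fk x); rewrite fx0 mulr0 ltxx.
  rewrite real_leNgt ?normr_real//; apply/negP => fx.
  pose q := `|f x| / `|x|; have q0 : 0 <= q by rewrite divr_ge0.
  have q1 : q < 1 by rewrite ltr_pdivrMr// mul1r.
  have k2 : 0 < (k + 1)^-1 by rewrite invr_gt0 addr_gt0.
  have [m hm] := exists_expr_le q0 q1 k2.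
  have : q ^+ (2 ^ m) <= (k + 1)^-1.
    apply: le_trans hm; apply: ler_wiXn2l => //; first exact: ltW.
    by rewrite ltnW// ltn_expl.
  rewrite expr_div_n ler_pdivrMr ?exprn_gt0// ler_pdivlMl ?addr_gt0//.
  move=> h1.
  have h2 : `|x| ^+ (2 ^ m) <= k * `|f x| ^+ (2 ^ m).
    rewrite -(norm_iter_sq m sx); apply: le_trans (fk _) _.
    by rewrite ler_wpM2l ?(ltW kp)//; exact: normfsq.
  have := le_trans h1 h2; rewrite mulrDl mul1r gerDl => fm.
  have : `|x| ^+ (2 ^ m) <= 0 by apply: le_trans h2 _; rewrite pmulr_rle0.
  by move/(lt_le_trans (exprn_gt0 _ xp)); rewrite ltxx.
move=> a; apply/eqP; rewrite eq_le star_hom_contractive//=.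
have := self (star a * a)%g; rewrite cstar_starM cstar_starK => /(_ erefl).
rewrite (star_homM hf) (star_hom_star hf) !cstar_norm_star.
by rewrite ler_pXn2r ?nnegrE.
Qed.

End Contractive.

(** * The C*-algebra of bounded adjointable operators *)

Section BoundedOperators.
Variables (R : realType).
Local Notation C := R[i].
Variable H : hilbertType C.

(** Linearity follows from the existence of an adjoint. Asking for the adjoint
    in the definition, instead of deducing it from boundedness, makes the Riesz
    representation theorem unnecessary. *)
Record bop := Bop {
  bop_fun :> H -> H;
  bop_bounded : exists2 c : C, 0 <= c & opnorm_le bop_fun c;
  bop_adjoint : exists g : H -> H, forall x y, dot (bop_fun x) y = dot x (g y)
}.

HB.instance Definition _ := gen_eqMixin bop.
HB.instance Definition _ := gen_choiceMixin bop.

Lemma bop_eq (f g : bop) : f =1 g -> f = g.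
Proof.
case: f g => [f fb fa] [g gb ga] /= /funext fg; case: _ / fg in gb ga *.
by congr Bop; exact: Prop_irrelevance.
Qed.

Lemma bopZD (f : bop) c x y : f (c *: x + y) = c *: f x + f y.
Proof.
have [g hg] := bop_adjoint f; apply: dot_extl => z.
by rewrite hg !dot_linearl !hg.
Qed.

Lemma bopD (f : bop) x y : f (x + y) = f x + f y.
Proof. by rewrite -[x in LHS]scale1r bopZD scale1r. Qed.

Lemma bop0 (f : bop) : f 0 = 0.
Proof. by apply: (addrI (f 0)); rewrite -bopD !addr0. Qed.

Lemma bopZ (f : bop) c x : f (c *: x) = c *: f x.
Proof. by rewrite -[c *: x]addr0 bopZD bop0 addr0. Qed.

Lemma bop_sum (f : bop) (I : Type) (r : seq I) (F : I -> H) :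
  f (\sum_(i <- r) F i) = \sum_(i <- r) f (F i).
Proof. by apply: (big_morph f) => [x y|]; rewrite ?bopD ?bop0. Qed.

(** The infimum is formed in [R], since [C] has no infima. *)
Definition opnorm (f : H -> H) : C :=
  (inf [set c : R | 0 <= c /\ opnorm_le f c%:C%C])%:C%C.

Lemma opnorm_ge0 (f : bop) : 0 <= opnorm f.
Proof.
rewrite ler0c; apply: lb_le_inf => [|c []//].
have [c c0 fc] := bop_bounded f.
by exists (complex.Re c); split; rewrite ?ge0_ReK// -ler0c ge0_ReK.
Qed.

Lemma opnorm_le_opnorm (f : H -> H) :
  (exists2 c : C, 0 <= c & opnorm_le f c) -> opnorm_le f (opnorm f).
Proof.
move=> [c0 c0_ge0 fc0] x.
have [->|x0] := eqVneq x 0; first by have := fc0 0; rewrite normr0 !mulr0.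
rewrite -ler_pdivrMr ?normr_gt0//.
rewrite -[X in X <= _]ge0_ReK ?divr_ge0// lecR; apply: lb_le_inf.
  by exists (complex.Re c0); split; rewrite ?ge0_ReK// -ler0c ge0_ReK.
by move=> c [_ hc]; rewrite -lecR ge0_ReK ?divr_ge0// ler_pdivrMr ?normr_gt0.
Qed.

Lemma opnorm_leP (f : H -> H) (c : C) :
  (exists2 c : C, 0 <= c & opnorm_le f c) ->
  0 <= c -> (opnorm f <= c <-> opnorm_le f c).
Proof.
move=> fb c0; split=> [fc x|fc].
  by apply: le_trans (opnorm_le_opnorm fb x) _; rewrite ler_wpM2r.
rewrite -[c]ge0_ReK// lecR; apply: ge_inf; first by exists 0 => ? [].
by split; rewrite ?ge0_ReK// -ler0c ge0_ReK.
Qed.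

Lemma bop_norm_le (f : bop) x : `|f x| <= opnorm f * `|x|.
Proof. exact: opnorm_le_opnorm (bop_bounded f) x. Qed.

Lemma opnorm_bop_le (f : bop) (c : C) : 0 <= c -> opnorm_le f c -> opnorm f <= c.
Proof. by move=> c0 fc; apply/opnorm_leP => //; exact: bop_bounded. Qed.

Fact bop_zero_subproof :
  (exists2 c : C, 0 <= c & @opnorm_le C H H (fun=> 0) c) /\
  exists g : H -> H, forall x y : H, dot 0 y = dot x (g y).
Proof.
split; first by exists 0 => // x; rewrite normr0 mul0r.
by exists (fun=> 0) => x y; rewrite dot0l dot0r.
Qed.
Definition bop_zero := Bop bop_zero_subproof.1 bop_zero_subproof.2.

Fact bop_add_subproof (f g : bop) :
  (exists2 c : C, 0 <= c & @opnorm_le C H H (fun x => f x + g x) c) /\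
  exists h : H -> H, forall x y : H, dot (f x + g x) y = dot x (h y).
Proof.
split.
  exists (opnorm f + opnorm g) => [|x]; first by rewrite addr_ge0 ?opnorm_ge0.
  by apply: le_trans (ler_normD _ _) _; rewrite mulrDl lerD ?bop_norm_le.
have [f' hf] := bop_adjoint f; have [g' hg] := bop_adjoint g.
by exists (fun x => f' x + g' x) => x y; rewrite dotDl dotDr hf hg.
Qed.
Definition bop_add f g :=
  Bop (bop_add_subproof f g).1 (bop_add_subproof f g).2.

Fact bop_scale_subproof (c : C) (f : bop) :
  (exists2 c' : C, 0 <= c' & @opnorm_le C H H (fun x => c *: f x) c') /\
  exists h : H -> H, forall x y : H, dot (c *: f x) y = dot x (h y).
Proof.
split.
  exists (`|c| * opnorm f) => [|x]; first by rewrite mulr_ge0 ?opnorm_ge0.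
  by rewrite normrZ -mulrA ler_wpM2l ?bop_norm_le.
have [f' hf] := bop_adjoint f.
by exists (fun x => c^* *: f' x) => x y; rewrite dotZl dotZr hf conjCK.
Qed.
Definition bop_scale c f :=
  Bop (bop_scale_subproof c f).1 (bop_scale_subproof c f).2.

Fact bop_mul_subproof (f g : bop) :
  (exists2 c : C, 0 <= c & @opnorm_le C H H (fun x => f (g x)) c) /\
  exists h : H -> H, forall x y : H, dot (f (g x)) y = dot x (h y).
Proof.
split.
  exists (opnorm f * opnorm g) => [|x]; first by rewrite mulr_ge0 ?opnorm_ge0.
  by apply: le_trans (bop_norm_le _ _) _; rewrite -mulrA ler_wpM2l ?bop_norm_le ?opnorm_ge0.
have [f' hf] := bop_adjoint f; have [g' hg] := bop_adjoint g.
by exists (fun x => g' (f' x)) => x y; rewrite hf hg.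
Qed.
Definition bop_mul f g :=
  Bop (bop_mul_subproof f g).1 (bop_mul_subproof f g).2.

Fact bop_one_subproof :
  (exists2 c : C, 0 <= c & @opnorm_le C H H id c) /\
  exists g : H -> H, forall x y : H, dot x y = dot x (g y).
Proof. by split; [exists 1 => // x; rewrite mul1r | exists id]. Qed.
Definition bop_one := Bop bop_one_subproof.1 bop_one_subproof.2.

Definition bop_star_fun (f : bop) : H -> H := projT1 (cid (bop_adjoint f)).

Lemma bop_star_funE (f : bop) x y : dot (f x) y = dot x (bop_star_fun f y).
Proof. exact: (projT2 (cid (bop_adjoint f))). Qed.

Lemma bop_star_fun_le (f : bop) : opnorm_le (bop_star_fun f) (opnorm f).
Proof.
move=> y; apply: norm_le_of_dot => [|x]; first by rewrite mulr_ge0 ?opnorm_ge0.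
rewrite dot_conj norm_conjC -bop_star_funE; apply: le_trans (cauchy_schwarz _ _) _.
by rewrite mulrAC ler_wpM2r ?bop_norm_le.
Qed.

Definition bop_star (f : bop) : bop.
Proof.
apply: (@Bop (bop_star_fun f)).
- by exists (opnorm f); [exact: opnorm_ge0 | exact: bop_star_fun_le].
- by exists f => x y; rewrite dot_conj -bop_star_funE -dot_conj.
Defined.

Fact bop_addA : associative bop_add.
Proof. by move=> f g h; apply: bop_eq => x /=; rewrite addrA. Qed.
Fact bop_addC : commutative bop_add.
Proof. by move=> f g; apply: bop_eq => x /=; rewrite addrC. Qed.
Fact bop_add0 : left_id bop_zero bop_add.
Proof. by move=> f; apply: bop_eq => x /=; rewrite add0r. Qed.
Fact bop_addN : left_inverse bop_zero (bop_scale (-1)) bop_add.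
Proof. by move=> f; apply: bop_eq => x /=; rewrite scaleN1r addNr. Qed.

HB.instance Definition _ :=
  GRing.isZmodule.Build bop bop_addA bop_addC bop_add0 bop_addN.

Fact bop_scaleA a b (f : bop) : bop_scale a (bop_scale b f) = bop_scale (a * b) f.
Proof. by apply: bop_eq => x /=; rewrite scalerA. Qed.
Fact bop_scale1 : left_id 1 bop_scale.
Proof. by move=> f; apply: bop_eq => x /=; rewrite scale1r. Qed.
Fact bop_scaleDr : right_distributive bop_scale +%R.
Proof. by move=> c f g; apply: bop_eq => x /=; rewrite scalerDr. Qed.
Fact bop_scaleDl f : {morph bop_scale^~ f : a b / a + b}.
Proof. by move=> a b; apply: bop_eq => x /=; rewrite scalerDl. Qed.

HB.instance Definition _ := GRing.Zmodule_isLmodule.Build C bop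
  bop_scaleA bop_scale1 bop_scaleDr bop_scaleDl.

Fact bop_normD (f g : bop) : opnorm (f + g) <= opnorm f + opnorm g.
Proof.
apply: opnorm_bop_le => [|x]; first by rewrite addr_ge0 ?opnorm_ge0.
by apply: le_trans (ler_normD _ _) _; rewrite mulrDl lerD ?bop_norm_le.
Qed.

Fact bop_normZ (c : C) (f : bop) : opnorm (c *: f) = `|c| * opnorm f.
Proof.
have le c' (g : bop) : opnorm (c' *: g) <= `|c'| * opnorm g.
  apply: opnorm_bop_le => [|x]; first by rewrite mulr_ge0 ?opnorm_ge0.
  by rewrite normrZ -mulrA ler_wpM2l ?bop_norm_le.
apply/eqP; rewrite eq_le le andTb; have [->|c0] := eqVneq c 0.
  by rewrite normr0 mul0r opnorm_ge0.
have := le c^-1 (c *: f); rewrite scalerA mulVf// scale1r normfV.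
by rewrite ler_pdivlMl ?normr_gt0.
Qed.

Fact bop_norm0_eq0 (f : bop) : opnorm f = 0 -> f = 0.
Proof.
move=> f0; apply: bop_eq => x; apply/eqP; rewrite -normr_le0.
by have := bop_norm_le f x; rewrite f0 mul0r.
Qed.

HB.instance Definition _ :=
  Lmodule_isNormed.Build C bop bop_normD bop_normZ bop_norm0_eq0.

Lemma bop_norm_leP (f : bop) (c : C) : 0 <= c -> `|f| <= c <-> opnorm_le f c.
Proof. by move=> c0; apply: opnorm_leP c0; exact: bop_bounded. Qed.

Lemma bopE_norm_le (f : bop) x : `|f x| <= `|f| * `|x|.
Proof. exact: bop_norm_le. Qed.

Lemma bop_starE (f : bop) x y : dot (f x) y = dot x (bop_star f y).
Proof. exact: bop_star_funE. Qed.

Lemma cvg_seq_dotl (u : nat -> H) l y :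
  cvg_seq u l -> cvg_seq (fun n => dot (u n) y : C^o) (dot l y).
Proof.
apply: (cvg_seq_dominated (normr_ge0 y)) => n.
by rewrite -dotBl mulrC cauchy_schwarz.
Qed.

Lemma cvg_seq_dotr (u : nat -> H) l y :
  cvg_seq u l -> cvg_seq (fun n => dot y (u n) : C^o) (dot y l).
Proof.
apply: (cvg_seq_dominated (normr_ge0 y)) => n.
by rewrite -dotBr cauchy_schwarz.
Qed.

(** The pointwise limits of the operators and of their adjoints are adjoint to each
    other. *)
Fact bop_seq_complete (u : nat -> bop) : cauchy_seq u -> exists l, cvg_seq u l.
Proof.
move=> cu.
have uB m n x : u m x - u n x = (u m - u n) x.
  by rewrite -[u m - u n]/(bop_add _ (bop_scale _ _)) /= scaleN1r.
have /choice[f hf] : forall x, exists y, cvg_seq (fun n => u n x) y.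
  move=> x; apply: cauchy_seq_cvg; apply: (cauchy_seq_sub (normr_ge0 x)) cu.
  by move=> m n; rewrite uB mulrC bopE_norm_le.
have /choice[g hg] : forall y, exists z, cvg_seq (fun n => bop_star (u n) y) z.
  move=> y; apply: cauchy_seq_cvg; apply: (cauchy_seq_sub (normr_ge0 y)) cu.
  move=> m n; apply: norm_le_of_dot => [|x]; first by rewrite mulr_ge0.
  rewrite dot_conj norm_conjC dotBr -!bop_starE -dotBl uB.
  apply: le_trans (cauchy_schwarz _ _) _.
  by rewrite mulrC -mulrA ler_wpM2l ?bopE_norm_le.
have f_adj : exists g : H -> H, forall x y, dot (f x) y = dot x (g y).
  exists g => x y.
  apply: (@cvg_seq_unique _ C^o (fun n => dot (u n x) y)); first exact: cvg_seq_dotl.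
  under eq_fun do rewrite bop_starE.
  exact: cvg_seq_dotr.
have [N0 hN0] := cu 1 ltr01.
have f_bnd : exists2 c : C, 0 <= c & opnorm_le f c.
  exists (1 + `|u N0|) => [|x]; first by rewrite addr_ge0.
  have fu : `|f x - u N0 x| <= 1 * `|x|.
    apply: (cvg_seq_norm_le (N := N0) (hf x)) => n Nn; rewrite uB.
    by apply: le_trans (bopE_norm_le _ _) _; rewrite ler_wpM2r ?hN0.
  rewrite -[f x](subrK (u N0 x)) mulrDl; apply: le_trans (ler_normD _ _) _.
  by rewrite lerD ?bopE_norm_le.
exists (Bop f_bnd f_adj) => e e0; have [N hN] := cu e e0.
exists N => n Nn; rewrite distrC; apply/bop_norm_leP; first exact: ltW.
move=> x; rewrite -[X in `|X|]/(f x + -1 *: u n x) scaleN1r.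
apply: (cvg_seq_norm_le (N := N) (hf x)) => m Nm; rewrite uB.
by apply: le_trans (bopE_norm_le _ _) _; rewrite ler_wpM2r ?hN.
Qed.

HB.instance Definition _ := Uniform_isComplete.Build bop
  (cauchy_complete_of_seq bop_seq_complete).

Fact bop_mulA : associative bop_mul.
Proof. by move=> f g h; apply: bop_eq. Qed.
Fact bop_mul1 : left_id bop_one bop_mul.
Proof. by move=> f; apply: bop_eq. Qed.
Fact bop_mulr1 : right_id bop_one bop_mul.
Proof. by move=> f; apply: bop_eq. Qed.

HB.instance Definition _ := isMonoid.Build bop bop_mulA bop_mul1 bop_mulr1.

Lemma bop_addE (f g : bop) x : (f + g) x = f x + g x. Proof. by []. Qed.
Lemma bop_scaleE c (f : bop) x : (c *: f) x = c *: f x. Proof. by []. Qed.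
Lemma bop_mulE (f g : bop) x : (f * g)%g x = f (g x). Proof. by []. Qed.

Lemma bop_sumE (I : Type) (r : seq I) (F : I -> bop) x :
  (\sum_(i <- r) F i) x = \sum_(i <- r) F i x.
Proof. by apply: (big_morph (fun f : bop => f x)). Qed.

Lemma bop_star_unique (f g : bop) :
  (forall x y, dot (f x) y = dot x (g y)) -> bop_star f = g.
Proof.
move=> fg; apply: bop_eq => y; apply: dot_extl => x.
by rewrite dot_conj -bop_starE fg -dot_conj.
Qed.

Fact bop_mulDl (f g h : bop) : ((f + g) * h)%g = (f * h)%g + (g * h)%g.
Proof. exact: bop_eq. Qed.
Fact bop_mulDr (f g h : bop) : (f * (g + h))%g = (f * g)%g + (f * h)%g.
Proof. by apply: bop_eq => x; exact: bopD. Qed.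
Fact bop_scaleAl c (f g : bop) : c *: (f * g)%g = ((c *: f) * g)%g.
Proof. exact: bop_eq. Qed.
Fact bop_scaleAr c (f g : bop) : c *: (f * g)%g = (f * (c *: g))%g.
Proof. by apply: bop_eq => x; rewrite -[RHS]/(f (c *: g x)) bopZ. Qed.
Fact bop_starD (f g : bop) : bop_star (f + g) = bop_star f + bop_star g.
Proof.
by apply: bop_star_unique => x y; rewrite dotDl !bop_starE -dotDr.
Qed.
Fact bop_starZ c (f : bop) : bop_star (c *: f) = c^* *: bop_star f.
Proof.
apply: bop_star_unique => x y.
by rewrite dotZl bop_starE -[RHS]/(dot x (c^* *: _)) dotZr conjCK.
Qed.
Fact bop_starM (f g : bop) : bop_star (f * g)%g = (bop_star g * bop_star f)%g.
Proof. by apply: bop_star_unique => x y; rewrite !bop_mulE !bop_starE. Qed.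
Fact bop_starK (f : bop) : bop_star (bop_star f) = f.
Proof.
by apply: bop_star_unique => x y; rewrite dot_conj -bop_starE -dot_conj.
Qed.
Fact bop_normM (f g : bop) : `|(f * g)%g| <= `|f| * `|g|.
Proof.
apply/bop_norm_leP => [|x]; first by rewrite mulr_ge0.
rewrite -mulrA; apply: le_trans (bopE_norm_le f (g x)) _.
by rewrite ler_wpM2l ?bopE_norm_le.
Qed.
Fact bop_norm_star_le (f : bop) : `|bop_star f| <= `|f|.
Proof. by apply/bop_norm_leP => //; exact: bop_star_fun_le. Qed.

Fact bop_norm_star (f : bop) : `|(bop_star f * f)%g| = `|f| ^+ 2.
Proof.
apply/eqP; rewrite eq_le expr2; apply/andP; split.
  by apply: le_trans (bop_normM _ _) _; rewrite ler_wpM2r ?bop_norm_star_le.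
rewrite -expr2 -[X in _ <= X]sqrtCK ler_pXn2r ?nnegrE ?sqrtC_ge0//.
apply/bop_norm_leP => [|x]; first by rewrite sqrtC_ge0.
rewrite -(@ler_pXn2r _ 2) ?nnegrE ?mulr_ge0 ?sqrtC_ge0//.
rewrite exprMn sqrtCK -dot_norm bop_starE.
rewrite -[X in X <= _]ger0_norm; last first.
  by rewrite -bop_starE dot_norm exprn_ge0.
apply: le_trans (cauchy_schwarz _ _) _.
by rewrite mulrC expr2 mulrA ler_wpM2r// (bopE_norm_le (bop_star f * f)%g x).
Qed.

HB.instance Definition _ := isCStarAlgebra.Build C bop
  bop_mulDl bop_mulDr bop_scaleAl bop_scaleAr bop_starD bop_starZ bop_starM
  bop_starK bop_normM bop_norm_star.

End BoundedOperators.

(** * C*-algebras generated inside a larger one *)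

Record star_subalgebra (C : numClosedFieldType) (A : cstarAlgType C) := {
  subalg_set :> set A;
  subalgZD : forall (z : C) a b,
    subalg_set a -> subalg_set b -> subalg_set (z *: a + b);
  subalg1 : subalg_set 1%g;
  subalgM : forall a b, subalg_set a -> subalg_set b -> subalg_set (a * b)%g;
  subalg_star : forall a, subalg_set a -> subalg_set (star a)
}.

Section Closure.
Variables (R : realType).
Local Notation C := R[i].
Variables (A : cstarAlgType C) (S : star_subalgebra A).

Definition norm_closure (P : set A) : set A :=
  [set a | forall e : C, 0 < e -> exists2 b, P b & `|a - b| <= e].

Lemma norm_closure_sub (P : set A) a : P a -> norm_closure P a.
Proof. by move=> Pa e e0; exists a; rewrite // subrr normr0 ltW. Qed.

Lemma closure_seq (P : set A) a : norm_closure P a ->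
  exists u : nat -> A, (forall n, P (u n)) /\ cvg_seq u a.
Proof.
move=> Pa; have /choice[u hu] : forall n : nat, exists b, P b /\ `|a - b| <= n.+1%:R^-1.
  by move=> n; have [|b ? ?] := Pa n.+1%:R^-1; [rewrite invr_gt0 ltr0Sn | exists b].
exists u; split=> [n|e e0]; first by case: (hu n).
have [N hN] := exists_invS_le e0; exists N => n Nn.
rewrite distrC; apply: le_trans (hu n).2 (le_trans _ hN).
by rewrite lef_pV2 ?posrE ?ltr0Sn// ler_nat.
Qed.

Lemma cvg_seq_closure (P : set A) (u : nat -> A) a :
  (forall n, norm_closure P (u n)) -> cvg_seq u a -> norm_closure P a.
Proof.
move=> uP ua e e0; have e2 : 0 < e / 2 by rewrite divr_gt0.
have [N hN] := ua _ e2; have [b Pb ub] := uP N _ e2; exists b => //.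
rewrite -(subrKA (u N)) (splitr e); apply: le_trans (ler_normD _ _) _.
by rewrite lerD// distrC hN.
Qed.

(** The closure of [S] as a C*-algebra in its own right; [csub_val] is the inclusion. *)
Record csub := Csub { csub_val : A; csubP : norm_closure S csub_val }.

HB.instance Definition _ := gen_eqMixin csub.
HB.instance Definition _ := gen_choiceMixin csub.

Lemma csub_val_inj : injective csub_val.
Proof.
move=> [a Pa] [b Pb] /= ab; case: _ / ab in Pb *.
by congr Csub; exact: Prop_irrelevance.
Qed.

Fact csubZD_subproof (z : C) (a b : csub) :
  norm_closure S (z *: csub_val a + csub_val b).
Proof.
have [u [Su ua]] := closure_seq (csubP a); have [v [Sv vb]] := closure_seq (csubP b).
move=> e e0; have z1 : 0 < `|z| + 1 by rewrite ltr_pwDr.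
have e2 : 0 < e / 2 by rewrite divr_gt0.
have [N hN] := ua _ (divr_gt0 e2 z1); have [M hM] := vb _ e2.
exists (z *: u N + v M); first exact: subalgZD.
rewrite opprD addrACA -scalerBr (splitr e); apply: le_trans (ler_normD _ _) _.
rewrite lerD//; last by rewrite distrC hM.
rewrite normrZ distrC; apply: le_trans (ler_wpM2l (normr_ge0 z) (hN _ (leqnn N))) _.
by rewrite mulrCA ler_piMr ?(ltW e2)// ler_pdivrMr// mul1r lerDl.
Qed.
Definition csubZD z a b := Csub (csubZD_subproof z a b).
(* [S] contains 0 as [-1 + 1]. *)
Definition csub0 := Csub (norm_closure_sub (subalgZD (- 1) (subalg1 S) (subalg1 S))).

Lemma csub0E : csub_val csub0 = 0.
Proof. by rewrite /= scaleN1r addNr. Qed.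

Fact csubM_subproof (a b : csub) : norm_closure S (csub_val a * csub_val b)%g.
Proof.
have [u [Su ua]] := closure_seq (csubP a).
apply: (cvg_seq_closure _ (cvg_seqMr _ ua)) => n.
have [v [Sv vb]] := closure_seq (csubP b).
apply: (cvg_seq_closure _ (cvg_seqMl _ vb)) => m.
by apply: norm_closure_sub; exact: subalgM.
Qed.
Definition csubM a b := Csub (csubM_subproof a b).
Definition csub1 := Csub (norm_closure_sub (subalg1 S)).

Fact csub_star_subproof (a : csub) : norm_closure S (star (csub_val a)).
Proof.
have [u [Su ua]] := closure_seq (csubP a).
apply: (cvg_seq_closure _ (cvg_seq_star ua)) => n.
by apply: norm_closure_sub; exact: subalg_star.
Qed.
Definition csub_star a := Csub (csub_star_subproof a).

Let add a b := csubZD 1 a b.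
Let scale z a := csubZD z a csub0.
Let opp a := scale (-1) a.

Let addE a b : csub_val (add a b) = csub_val a + csub_val b.
Proof. by rewrite /= scale1r. Qed.
Let scaleE z a : csub_val (scale z a) = z *: csub_val a.
Proof. by rewrite /= scaleN1r addNr addr0. Qed.

Fact csub_addA : associative add.
Proof. by move=> a b c; apply: csub_val_inj; rewrite !addE addrA. Qed.
Fact csub_addC : commutative add.
Proof. by move=> a b; apply: csub_val_inj; rewrite !addE addrC. Qed.
Fact csub_add0 : left_id csub0 add.
Proof. by move=> a; apply: csub_val_inj; rewrite addE csub0E add0r. Qed.
Fact csub_addN : left_inverse csub0 opp add.
Proof.
by move=> a; apply: csub_val_inj; rewrite addE scaleE csub0E scaleN1r addNr.
Qed.
HB.instance Definition _ :=
  GRing.isZmodule.Build csub csub_addA csub_addC csub_add0 csub_addN.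

Lemma csub_addE (a b : csub) : csub_val (a + b) = csub_val a + csub_val b.
Proof. exact: addE. Qed.

Fact csub_scaleA a b (f : csub) : scale a (scale b f) = scale (a * b) f.
Proof. by apply: csub_val_inj; rewrite !scaleE scalerA. Qed.
Fact csub_scale1 : left_id 1 scale.
Proof. by move=> f; apply: csub_val_inj; rewrite scaleE scale1r. Qed.
Fact csub_scaleDr : right_distributive scale +%R.
Proof.
by move=> c f g; apply: csub_val_inj; rewrite csub_addE !scaleE csub_addE scalerDr.
Qed.
Fact csub_scaleDl f : {morph scale^~ f : a b / a + b}.
Proof.
by move=> a b; apply: csub_val_inj; rewrite csub_addE !scaleE scalerDl.
Qed.
HB.instance Definition _ := GRing.Zmodule_isLmodule.Build C csub
  csub_scaleA csub_scale1 csub_scaleDr csub_scaleDl.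

Lemma csub_scaleE z (a : csub) : csub_val (z *: a) = z *: csub_val a.
Proof. exact: scaleE. Qed.

Let norm (a : csub) : C := `|csub_val a|.

Fact csub_normD (f g : csub) : norm (f + g) <= norm f + norm g.
Proof. by rewrite /norm csub_addE ler_normD. Qed.
Fact csub_normZ (c : C) (f : csub) : norm (c *: f) = `|c| * norm f.
Proof. by rewrite /norm csub_scaleE normrZ. Qed.
Fact csub_norm0_eq0 (f : csub) : norm f = 0 -> f = 0.
Proof.
by move=> /normr0_eq0 f0; apply: csub_val_inj; rewrite f0 -csub0E.
Qed.
HB.instance Definition _ :=
  Lmodule_isNormed.Build C csub csub_normD csub_normZ csub_norm0_eq0.

Lemma csub_normE (a : csub) : `|a| = `|csub_val a|.
Proof. by []. Qed.

Lemma csub_subE (a b : csub) : csub_val (a - b) = csub_val a - csub_val b.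
Proof. by rewrite csub_addE -scaleN1r csub_scaleE scaleN1r. Qed.

Fact csub_seq_complete (u : nat -> csub) : cauchy_seq u -> exists l, cvg_seq u l.
Proof.
move=> cu; have /cauchy_seq_cvg[l ul] : cauchy_seq (csub_val \o u).
  by apply: (cauchy_seq_sub ler01) cu => m n; rewrite mul1r csub_normE csub_subE.
exists (Csub (cvg_seq_closure (fun n => csubP (u n)) ul)).
apply: (cvg_seq_dominated ler01 _ ul) => n.
by rewrite mul1r csub_normE csub_subE.
Qed.
HB.instance Definition _ := Uniform_isComplete.Build csub
  (cauchy_complete_of_seq csub_seq_complete).

Fact csub_mulA : associative csubM.
Proof. by move=> f g h; apply: csub_val_inj; exact: mulgA. Qed.
Fact csub_mul1 : left_id csub1 csubM.
Proof. by move=> f; apply: csub_val_inj; exact: mul1g. Qed.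
Fact csub_mulr1 : right_id csub1 csubM.
Proof. by move=> f; apply: csub_val_inj; exact: mulg1. Qed.
HB.instance Definition _ := isMonoid.Build csub csub_mulA csub_mul1 csub_mulr1.

Lemma csub_mulE (a b : csub) : csub_val (a * b)%g = (csub_val a * csub_val b)%g.
Proof. by []. Qed.

Fact csub_mulDl (f g h : csub) : ((f + g) * h)%g = (f * h)%g + (g * h)%g.
Proof. by apply: csub_val_inj; rewrite csub_mulE !csub_addE cstar_mulDl. Qed.
Fact csub_mulDr (f g h : csub) : (f * (g + h))%g = (f * g)%g + (f * h)%g.
Proof. by apply: csub_val_inj; rewrite csub_mulE !csub_addE cstar_mulDr. Qed.
Fact csub_scaleAl c (f g : csub) : c *: (f * g)%g = ((c *: f) * g)%g.
Proof. by apply: csub_val_inj; rewrite csub_mulE !csub_scaleE cstar_scaleAl. Qed.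
Fact csub_scaleAr c (f g : csub) : c *: (f * g)%g = (f * (c *: g))%g.
Proof. by apply: csub_val_inj; rewrite csub_mulE !csub_scaleE cstar_scaleAr. Qed.
Fact csub_starD (f g : csub) : csub_star (f + g) = csub_star f + csub_star g.
Proof. by apply: csub_val_inj; rewrite csub_addE /= scale1r cstar_starD. Qed.
Fact csub_starZ c (f : csub) : csub_star (c *: f) = c^* *: csub_star f.
Proof.
apply: csub_val_inj.
by rewrite csub_scaleE -[LHS]/(star (csub_val (c *: f))) csub_scaleE cstar_starZ.
Qed.
Fact csub_starM (f g : csub) : csub_star (f * g)%g = (csub_star g * csub_star f)%g.
Proof. by apply: csub_val_inj; exact: cstar_starM. Qed.
Fact csub_starK (f : csub) : csub_star (csub_star f) = f.
Proof. by apply: csub_val_inj; exact: cstar_starK. Qed.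
Fact csub_normM (f g : csub) : `|(f * g)%g| <= `|f| * `|g|.
Proof. exact: cstar_normM. Qed.
Fact csub_norm_star (f : csub) : `|(csub_star f * f)%g| = `|f| ^+ 2.
Proof. exact: cstar_norm_star. Qed.

HB.instance Definition _ := isCStarAlgebra.Build C csub
  csub_mulDl csub_mulDr csub_scaleAl csub_scaleAr csub_starD csub_starZ
  csub_starM csub_starK csub_normM csub_norm_star.

Lemma csub_val_star_hom : star_hom csub_val.
Proof. by split=> // z a b; rewrite csub_addE csub_scaleE. Qed.

Definition csub_in a (Sa : subalg_set S a) : csub := Csub (norm_closure_sub Sa).

Lemma csub_in_dense : dense [set x : csub | subalg_set S (csub_val x)].
Proof.
apply/dense_normP => x e e0; have [b Sb xb] := csubP x e0.
by exists (csub_in Sb) => //; rewrite csub_normE csub_subE.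
Qed.

End Closure.

(** * Unconditional sums of complex families *)

Section HasSum.
Variables (R : realType) (I : choiceType).
Local Notation C := R[i].
Implicit Types (F G : I -> C) (A B : {fset I}).

(** Convergence along the finite subsets of [I], which may be uncountable. *)
Definition has_sum F (s : C) := forall e : C, 0 < e -> exists A : {fset I},
  forall B, fsubset A B -> `|\sum_(i <- B) F i - s| <= e.

Lemma sum_fset_split A B F : fsubset A B ->
  \sum_(i <- B) F i = \sum_(i <- A) F i + \sum_(i <- B | i \notin A) F i.
Proof.
move=> /fsubsetP AB; rewrite (bigID (fun i => i \in A)) /=; congr (_ + _).
rewrite -big_filter; apply: perm_big; apply: uniq_perm => [||i].
- by rewrite filter_uniq// fset_uniq.
- exact: fset_uniq.
by rewrite mem_filter; apply/andP/idP => [[]|iA]//; split=> //; exact: AB.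
Qed.

Lemma has_sum_unique F s s' : has_sum F s -> has_sum F s' -> s = s'.
Proof.
move=> hs hs'; apply/eqP; rewrite -subr_eq0 -normr_le0.
apply/ler_addgt0Pr => e e0; have e2 : 0 < e / 2 by rewrite divr_gt0.
have [A hA] := hs _ e2; have [A' hA'] := hs' _ e2.
rewrite add0r -(subrKA (\sum_(i <- (A `|` A')%fset) F i)) (splitr e).
apply: le_trans (ler_normD _ _) _; rewrite lerD//.
  by rewrite distrC hA// fsubsetUl.
by rewrite hA'// fsubsetUr.
Qed.

Lemma has_sumZD (c : C) F G s t : has_sum F s -> has_sum G t ->
  has_sum (fun i => c * F i + G i) (c * s + t).
Proof.
move=> hs ht e e0; have c1 : 0 < `|c| + 1 by rewrite ltr_pwDr.
have e2 : 0 < e / 2 by rewrite divr_gt0.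
have [A hA] := hs _ (divr_gt0 e2 c1); have [A' hA'] := ht _ e2.
exists (A `|` A')%fset => B; rewrite fsubUset => /andP[AB A'B].
rewrite big_split /= -mulr_sumr opprD addrACA -mulrBr (splitr e).
apply: le_trans (ler_normD _ _) _; rewrite lerD ?hA'// normrM.
apply: le_trans (ler_wpM2l (normr_ge0 c) (hA _ AB)) _.
by rewrite mulrCA ler_piMr ?(ltW e2)// ler_pdivrMr// mul1r lerDl.
Qed.

Lemma has_sum_conj F s : has_sum F s -> has_sum (fun i => (F i)^*) s^*.
Proof.
move=> hs e /hs[A hA]; exists A => B /hA.
by rewrite -norm_conjC rmorphB rmorph_sum.
Qed.

Lemma has_sum_ge_partial F s A :
  (forall i, 0 <= F i) -> has_sum F s -> \sum_(i <- A) F i <= s.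
Proof.
move=> F0 hs; rewrite -subr_ge0; apply: ge0_approx => e /hs[A' hA'].
exists (\sum_(i <- (A `|` A')%fset | i \notin A) F i); first exact: sumr_ge0.
rewrite -addrA -opprD -sum_fset_split ?fsubsetUl//.
by rewrite distrC hA'// fsubsetUr.
Qed.

Lemma has_sum_le F s (c : C) :
  has_sum F s -> (forall A, \sum_(i <- A) F i <= c) -> s <= c.
Proof.
move=> hs Fc; rewrite -subr_ge0; apply: ge0_approx => e /hs[A hA].
exists (c - \sum_(i <- A) F i); first by rewrite subr_ge0.
by rewrite opprB addrC addrA subrK hA// fsubset_refl.
Qed.

(** The supremum of the partial sums of [|F|] is approached along finite sets
    whose complements carry arbitrarily little mass. *)
Lemma abs_bounded_has_sum F (M : C) :
  (forall A, \sum_(i <- A) `|F i| <= M) -> exists s, has_sum F s.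
Proof.
move=> FM; pose N A : R := complex.Re (\sum_(i <- A) `|F i|).
have NE A : (N A)%:C%C = \sum_(i <- A) `|F i| by rewrite ge0_ReK ?sumr_ge0.
have M0 : 0 <= M by have := FM fset0; rewrite big_seq_fset0.
have Nsup : has_sup [set N A | A in [set: {fset I}]].
  split; first by exists (N fset0), fset0.
  by exists (complex.Re M) => _ [A _ <-]; rewrite -lecR NE ge0_ReK.
have /choice[A hA] : forall n : nat, exists A, forall B, fsubset A B ->
    `|\sum_(i <- B) F i - \sum_(i <- A) F i| <= (n.+1%:R^-1 : C).
  move=> n; have n0 : 0 < n.+1%:R^-1 :> R by rewrite invr_gt0 ltr0Sn.
  have [_ [A _ <-] hA] := sup_adherent n0 Nsup.
  exists A => B AB; rewrite (sum_fset_split _ AB) addrC addKr.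
  apply: le_trans (ler_norm_sum _ _ _) _.
  have : N B <= sup [set N A | A in [set: {fset I}]].
    by apply: ub_le_sup; [case: Nsup | exists B].
  rewrite ltrBlDr in hA; move=> /(le_trans)/(_ (ltW hA)).
  by rewrite -lecR rmorphD /= !NE (sum_fset_split _ AB) lerD2l fmorphV rmorph_nat.
have inv2 (e : C) : 0 < e -> exists N, forall n, (N <= n)%N -> n.+1%:R^-1 <= e.
  move=> e0; have [k hk] := exists_invS_le e0; exists k => n kn.
  by apply: le_trans hk; rewrite lef_pV2 ?posrE ?ltr0Sn// ler_nat.
have [s hs] : exists s : C^o, cvg_seq (fun n => \sum_(i <- A n) F i : C^o) s.
  apply: complex_seq_complete => e e0; have e2 : 0 < e / 2 by rewrite divr_gt0.
  have [k hk] := inv2 _ e2; exists k => m n km kn.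
  rewrite -(subrKA (\sum_(i <- (A m `|` A n)%fset) F i)) (splitr e).
  apply: le_trans (ler_normD _ _) _; rewrite lerD//.
    by rewrite distrC (le_trans (hA m _ _))// ?fsubsetUl ?hk.
  by rewrite (le_trans (hA n _ _))// ?fsubsetUr ?hk.
exists s => e e0; have e2 : 0 < e / 2 by rewrite divr_gt0.
have [k hk] := inv2 _ e2; have [k' hk'] := hs _ e2.
exists (A (maxn k k')) => B AB.
rewrite -(subrKA (\sum_(i <- A (maxn k k')) F i)) (splitr e).
apply: le_trans (ler_normD _ _) _; rewrite lerD ?hk' ?leq_maxr//.
by rewrite (le_trans (hA _ _ AB))// hk ?leq_maxl.
Qed.

End HasSum.

Lemma has_sum_finite (R : realType) (J : finType) (F : J -> R[i]) :
  has_sum F (\sum_i F i).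
Proof.
move=> e e0; exists [fset x in enum J]%fset => B /fsubsetP AB.
suff -> : \sum_(i <- B) F i = \sum_i F i by rewrite subrr normr0 ltW.
apply: perm_big; apply: uniq_perm => [||i].
- exact: fset_uniq.
- exact: index_enum_uniq.
by rewrite mem_index_enum; apply: AB; rewrite inE /= mem_enum.
Qed.


(** [C] as a Hilbert space over itself; the alias keeps its instances apart from
    those of the regular module of a real field. *)
Definition cline (R : realType) : Type := R[i].

Section ComplexLine.
Variable R : realType.
Local Notation C := R[i].

HB.instance Definition _ := NormedModule.copy (cline R) C^o.
HB.instance Definition _ := Uniform_isComplete.Build (cline R)
  (@cauchy_complete_of_seq R (cline R) (@complex_seq_complete R)).

Definition cline_dot (x y : cline R) : C := (x : C) * (y : C)^*.

Fact cline_dot_linearl (c : C) (x y z : cline R) :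
  cline_dot (c *: x + y) z = c * cline_dot x z + cline_dot y z.
Proof. by rewrite /cline_dot mulrDl -mulrA. Qed.
Fact cline_dot_conj (x y : cline R) : cline_dot y x = (cline_dot x y)^*.
Proof. by rewrite /cline_dot rmorphM /= conjCK mulrC. Qed.
Fact cline_dot_norm (x : cline R) : cline_dot x x = `|x| ^+ 2.
Proof. by rewrite /cline_dot -normCK. Qed.

HB.instance Definition _ := isHilbert.Build C (cline R)
  cline_dot_linearl cline_dot_conj cline_dot_norm.
End ComplexLine.

(** * Hilbert direct sums *)

Section HilbertSum.
Variables (R : realType) (I : choiceType).
Local Notation C := R[i].
Variable H : I -> hilbertType C.

Definition square_summable (f : forall i, H i) :=
  exists M : C, forall A : {fset I}, \sum_(i <- A) `|f i| ^+ 2 <= M.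

Record ell2 := Ell2 { ell2_fun :> forall i, H i; ell2P : square_summable ell2_fun }.

HB.instance Definition _ := gen_eqMixin ell2.
HB.instance Definition _ := gen_choiceMixin ell2.

Lemma ell2_eq (f g : ell2) : (forall i, f i = g i) -> f = g.
Proof.
case: f g => [f fP] [g gP] /= fg.
have {}fg : f = g by apply: functional_extensionality_dep.
by case: _ / fg in gP *; congr Ell2; exact: Prop_irrelevance.
Qed.

Lemma square_summableZD (c : C) (f g : forall i, H i) :
  square_summable f -> square_summable g ->
  square_summable (fun i => c *: f i + g i).
Proof.
move=> [M fM] [N gN]; exists (2 * `|c| ^+ 2 * M + 2 * N) => A.
apply: (@le_trans _ _ (\sum_(i <- A) (2 * `|c| ^+ 2 * `|f i| ^+ 2 + 2 * `|g i| ^+ 2))).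
  apply: ler_sum => i _.
  have h : `|c *: f i + g i| <= `|c| * `|f i| + `|g i|.
    by apply: le_trans (ler_normD _ _) _; rewrite normrZ.
  have cf0 : 0 <= `|c| * `|f i| by rewrite mulr_ge0.
  apply: (@le_trans _ _ ((`|c| * `|f i| + `|g i|) ^+ 2)).
    by rewrite ler_pXn2r ?nnegrE ?addr_ge0.
  have -> : 2 * `|c| ^+ 2 * `|f i| ^+ 2 + 2 * `|g i| ^+ 2 =
    (`|c| * `|f i| + `|g i|) ^+ 2 + (`|c| * `|f i| - `|g i|) ^+ 2 by ring.
  by rewrite lerDl -real_normK ?exprn_ge0// rpredB ?ger0_real.
by rewrite big_split /= -!mulr_sumr lerD// ler_wpM2l// mulr_ge0// exprn_ge0.
Qed.

Definition ell2ZD (c : C) (f g : ell2) : ell2 :=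
  Ell2 (square_summableZD c (ell2P f) (ell2P g)).

Fact ell2_zero_subproof : square_summable (fun i => 0 : H i).
Proof. by exists 0 => A; rewrite big1// => i _; rewrite normr0 expr0n. Qed.
Definition ell2_zero := Ell2 ell2_zero_subproof.

Let add f g := ell2ZD 1 f g.
Let scale c f := ell2ZD c f ell2_zero.
Let opp f := scale (-1) f.

Fact ell2_addA : associative add.
Proof. by move=> a b c; apply: ell2_eq => i /=; rewrite !scale1r addrA. Qed.
Fact ell2_addC : commutative add.
Proof. by move=> a b; apply: ell2_eq => i /=; rewrite !scale1r addrC. Qed.
Fact ell2_add0 : left_id ell2_zero add.
Proof. by move=> a; apply: ell2_eq => i /=; rewrite !scale1r add0r. Qed.
Fact ell2_addN : left_inverse ell2_zero opp add.
Proof.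
by move=> a; apply: ell2_eq => i /=; rewrite scale1r scaleN1r addr0 addNr.
Qed.
HB.instance Definition _ :=
  GRing.isZmodule.Build ell2 ell2_addA ell2_addC ell2_add0 ell2_addN.

Lemma ell2_addE (f g : ell2) i : (f + g) i = f i + g i.
Proof. by rewrite -[LHS]/(1 *: f i + g i) scale1r. Qed.

Fact ell2_scaleA a b (f : ell2) : scale a (scale b f) = scale (a * b) f.
Proof. by apply: ell2_eq => i /=; rewrite !addr0 scalerA. Qed.
Fact ell2_scale1 : left_id 1 scale.
Proof. by move=> f; apply: ell2_eq => i /=; rewrite addr0 scale1r. Qed.
Fact ell2_scaleDr : right_distributive scale +%R.
Proof.
by move=> c f g; apply: ell2_eq => i; rewrite ell2_addE /= !addr0 !scale1r scalerDr.
Qed.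
Fact ell2_scaleDl f : {morph scale^~ f : a b / a + b}.
Proof. by move=> a b; apply: ell2_eq => i; rewrite ell2_addE /= !addr0 scalerDl. Qed.
HB.instance Definition _ := GRing.Zmodule_isLmodule.Build C ell2
  ell2_scaleA ell2_scale1 ell2_scaleDr ell2_scaleDl.

Lemma ell2_scaleE c (f : ell2) i : (c *: f) i = c *: f i.
Proof. by rewrite -[LHS]/(c *: f i + 0) addr0. Qed.

Lemma ell2_subE (f g : ell2) i : (f - g) i = f i - g i.
Proof. by rewrite ell2_addE -scaleN1r ell2_scaleE scaleN1r. Qed.

Lemma ell2_sumE (J : Type) (r : seq J) (F : J -> ell2) i :
  (\sum_(j <- r) F j) i = \sum_(j <- r) F j i.
Proof. by elim: r => [|j r IH]; rewrite ?big_nil// !big_cons ell2_addE IH. Qed.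

(** By the inequality [a b <= a^2 + b^2] for nonnegative reals. *)
Lemma ell2_dot_summable (f g : ell2) :
  exists s : C, has_sum (fun i => dot (f i) (g i)) s.
Proof.
have [M fM] := ell2P f; have [N gN] := ell2P g.
apply: (@abs_bounded_has_sum _ _ _ (M + N)) => A.
apply: le_trans (lerD (fM A) (gN A)); rewrite -big_split /=.
apply: ler_sum => i _; apply: le_trans (cauchy_schwarz _ _) _.
rewrite -subr_ge0; have := normr_ge0 (f i); have := normr_ge0 (g i).
move: `|f i| `|g i| => a b b0 a0.
have -> : a ^+ 2 + b ^+ 2 - a * b = 2^-1 * (a ^+ 2 + b ^+ 2 + (a - b) ^+ 2) by field.
have ab : 0 <= (a - b) ^+ 2 by rewrite -real_normK ?exprn_ge0// rpredB ?ger0_real.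
by rewrite mulr_ge0 ?invr_ge0 ?addr_ge0// exprn_ge0.
Qed.

Definition ell2_dot (f g : ell2) : C := projT1 (cid (ell2_dot_summable f g)).

Lemma ell2_dotP (f g : ell2) : has_sum (fun i => dot (f i) (g i)) (ell2_dot f g).
Proof. exact: (projT2 (cid (ell2_dot_summable f g))). Qed.

Lemma ell2_dotE (f g : ell2) s :
  has_sum (fun i => dot (f i) (g i)) s -> ell2_dot f g = s.
Proof. exact: has_sum_unique (ell2_dotP f g). Qed.

Lemma ell2_dot_self (f : ell2) : has_sum (fun i => `|f i| ^+ 2) (ell2_dot f f).
Proof.
by have := ell2_dotP f f; under eq_fun do rewrite dot_norm.
Qed.

Lemma ell2_inner_form : inner_form ell2_dot.
Proof.
split=> [c f g h|f g|f|f f0].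
- apply: ell2_dotE; under eq_fun do rewrite ell2_addE ell2_scaleE dot_linearl.
  by apply: has_sumZD; exact: ell2_dotP.
- apply: ell2_dotE; under eq_fun do rewrite dot_conj.
  by apply: has_sum_conj; exact: ell2_dotP.
- have := has_sum_ge_partial fset0 _ (ell2_dot_self f).
  by rewrite big_seq_fset0; apply => i; exact: exprn_ge0.
apply: ell2_eq => i; apply/eqP; rewrite -normr_eq0 -sqrf_eq0 eq_le exprn_ge0// andbT.
have := has_sum_ge_partial [fset i]%fset _ (ell2_dot_self f).
by rewrite big_seq_fset1 f0; apply => j; exact: exprn_ge0.
Qed.

Let norm := form_norm ell2_dot.

HB.instance Definition _ := Lmodule_isNormed.Build C ell2
  (form_normD ell2_inner_form) (form_normZ ell2_inner_form)
  (form_norm_eq0 ell2_inner_form).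

Lemma ell2_normE (f : ell2) : `|f| ^+ 2 = ell2_dot f f.
Proof. exact: sqrtCK. Qed.

Lemma ell2_norm_has_sum (f : ell2) : has_sum (fun i => `|f i| ^+ 2) (`|f| ^+ 2).
Proof. by rewrite ell2_normE; exact: ell2_dot_self. Qed.

Lemma ell2_norm_partial (f : ell2) (A : {fset I}) : \sum_(i <- A) `|f i| ^+ 2 <= `|f| ^+ 2.
Proof.
apply: (@has_sum_ge_partial _ _ (fun i => `|f i| ^+ 2)) => [i|].
  exact: exprn_ge0.
exact: ell2_norm_has_sum.
Qed.

Lemma ell2_coord_le (f : ell2) i : `|f i| <= `|f|.
Proof.
have := ell2_norm_partial f [fset i]%fset.
by rewrite big_seq_fset1 ler_pXn2r ?nnegrE.
Qed.

Lemma ell2_norm_le (f : ell2) (c : C) : 0 <= c ->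
  (forall A : {fset I}, \sum_(i <- A) `|f i| ^+ 2 <= c ^+ 2) -> `|f| <= c.
Proof.
move=> c0 fc; rewrite -(@ler_pXn2r _ 2) ?nnegrE//.
exact: has_sum_le (ell2_norm_has_sum f) fc.
Qed.

(** The coordinatewise limit [l] of a Cauchy sequence is also its limit in norm:
    the bounds on [|u n - u m|^2] pass to the limit in [m] in every finite sum of
    coordinates. *)
Fact ell2_seq_complete (u : nat -> ell2) : cauchy_seq u -> exists l, cvg_seq u l.
Proof.
move=> cu.
have /(_ _)/cid-/all_sig[l ul] : forall i, exists y, cvg_seq (fun n => u n i) y.
  move=> i; apply: cauchy_seq_cvg; apply: (cauchy_seq_sub ler01) cu => m n.
  by rewrite mul1r -ell2_subE ell2_coord_le.
have close (e : C) N : 0 <= e ->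
    (forall m n, (N <= m)%N -> (N <= n)%N -> `|u m - u n| <= e) ->
    forall n, (N <= n)%N -> forall A : {fset I}, \sum_(i <- A) `|u n i - l i| ^+ 2 <= e ^+ 2.
  move=> e0 hN n Nn A.
  have lim : cvg_seq (fun m => \sum_(i <- A) `|u n i - u m i| ^+ 2 : C^o)
                     (\sum_(i <- A) `|u n i - l i| ^+ 2).
    apply: (@cvg_seq_sum _ C^o) => i; apply: cvg_seq_sqnorm.
    apply: (cvg_seq_dominated ler01 _ (ul i)) => m.
    by rewrite mul1r opprB addrC subrKA distrC.
  apply: (cvg_seq_le (N := N) lim) => m Nm.
  have := ell2_norm_partial (u n - u m) A.
  under eq_bigr do rewrite ell2_subE.
  by move=> /le_trans; apply; rewrite ler_pXn2r ?nnegrE ?hN.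
have [N0 hN0] := cu 1 ltr01.
have lP : square_summable l.
  have ul2 : square_summable (fun i => u N0 i - l i).
    by exists (1 ^+ 2) => A; apply: (close _ _ ler01 hN0) (leqnn N0) A.
  have := square_summableZD (-1) ul2 (ell2P (u N0)).
  congr square_summable; apply: functional_extensionality_dep => i.
  by rewrite scaleN1r opprB subrK.
exists (Ell2 lP) => e e0; have [N hN] := cu e e0; exists N => n Nn.
apply: ell2_norm_le (ltW e0) _ => A; under eq_bigr do rewrite ell2_subE.
exact: (close _ _ (ltW e0) hN _ Nn A).
Qed.

HB.instance Definition _ := Uniform_isComplete.Build ell2
  (cauchy_complete_of_seq ell2_seq_complete).

Fact ell2_dot_linearl (c : C) (f g h : ell2) :
  ell2_dot (c *: f + g) h = c * ell2_dot f h + ell2_dot g h.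
Proof. by case: ell2_inner_form. Qed.
Fact ell2_dot_conj (f g : ell2) : ell2_dot g f = (ell2_dot f g)^*.
Proof. by case: ell2_inner_form. Qed.
Fact ell2_dot_norm (f : ell2) : ell2_dot f f = `|f| ^+ 2.
Proof. by rewrite ell2_normE. Qed.
HB.instance Definition _ := isHilbert.Build C ell2
  ell2_dot_linearl ell2_dot_conj ell2_dot_norm.

Lemma dot_ell2P (f g : ell2) : has_sum (fun i => dot (f i) (g i)) (dot f g).
Proof. exact: ell2_dotP. Qed.

End HilbertSum.

(** * Operators on Hilbert direct sums *)

Section DirectSumOperators.
Variables (R : realType) (I : choiceType).
Local Notation C := R[i].
Variable H : I -> hilbertType C.
Variable x : forall i, bop (H i).
Arguments x i : clear implicits.
Hypothesis x_bounded : exists M : C, forall i, `|x i| <= M.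

Let bound : exists2 M : C, 0 <= M & forall i, `|x i| <= M.
Proof.
(* A bound may be negative if [I] is empty. *)
case: x_bounded => M xM; have [[i _]|noI] := pselect (exists i : I, True).
  by exists M => //; apply: le_trans (xM i).
by exists 0 => // i; case: noI; exists i.
Qed.

Lemma diag_partial_le (f : ell2 H) (M : C) (A : {fset I}) :
  0 <= M -> (forall i, `|x i| <= M) ->
  \sum_(i <- A) `|x i (f i)| ^+ 2 <= (M * `|f|) ^+ 2.
Proof.
move=> M0 xM; rewrite exprMn.
apply: le_trans (ler_wpM2l (exprn_ge0 2 M0) (ell2_norm_partial f A)).
rewrite mulr_sumr; apply: ler_sum => i _; rewrite -exprMn ler_pXn2r ?nnegrE ?mulr_ge0//.
by apply: le_trans (bopE_norm_le _ _) _; rewrite ler_wpM2r.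
Qed.

Lemma diag_square_summable (f : ell2 H) : square_summable (fun i => x i (f i)).
Proof. by have [M M0 xM] := bound; exists ((M * `|f|) ^+ 2) => A; exact: diag_partial_le. Qed.

Definition diag_fun (f : ell2 H) : ell2 H := Ell2 (diag_square_summable f).
End DirectSumOperators.

Section DirectSumBop.
Variables (R : realType) (I : choiceType).
Local Notation C := R[i].
Variable H : I -> hilbertType C.

Definition uniformly_bounded (x : forall i, bop (H i)) :=
  exists M : C, forall i, `|x i| <= M.

Lemma uniformly_bounded_star x :
  uniformly_bounded x -> uniformly_bounded (fun i => star (x i)).
Proof. by move=> [M xM]; exists M => i; rewrite norm_star xM. Qed.

Fact bdiag_subproof x (xb : uniformly_bounded x) :
  (exists2 c : C, 0 <= c & opnorm_le (diag_fun xb) c) /\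
  exists g : ell2 H -> ell2 H, forall f h, dot (diag_fun xb f) h = dot f (g h).
Proof.
split.
  have [M0 xM0] := xb; pose M : C := `|M0|.
  have xM i : `|x i| <= M.
    apply: le_trans (xM0 i) _.
    by rewrite real_ler_norm// (ger_real (xM0 i)) ?normr_real.
  have M_ge0 : 0 <= M := normr_ge0 _.
  exists M => // f; apply: ell2_norm_le => [|A]; first by rewrite mulr_ge0.
  exact: diag_partial_le.
exists (diag_fun (uniformly_bounded_star xb)) => f h.
apply: has_sum_unique (dot_ell2P _ _) _.
have := dot_ell2P f (diag_fun (uniformly_bounded_star xb) h).
by congr (has_sum _ _); apply/funext => i; rewrite /= bop_starE.
Qed.

Definition bdiag x (xb : uniformly_bounded x) : bop (ell2 H) :=
  Bop (bdiag_subproof xb).1 (bdiag_subproof xb).2.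

Lemma star_bdiag x (xb : uniformly_bounded x) :
  star (bdiag xb) = bdiag (uniformly_bounded_star xb).
Proof.
apply: bop_star_unique => f h; apply: has_sum_unique (dot_ell2P _ _) _.
have := dot_ell2P f (bdiag (uniformly_bounded_star xb) h).
by congr (has_sum _ _); apply/funext => i; rewrite /= bop_starE.
Qed.

End DirectSumBop.

Section FiniteSum.
Variables (R : realType) (n : nat).
Local Notation C := R[i].

Section Fin.
Variable H : hilbertType C.
Local Notation Hn := (ell2 (fun _ : 'I_n => H)).

Fact fin_square_summable (f : 'I_n -> H) : square_summable f.
Proof.
exists (\sum_i `|f i| ^+ 2) => A.
have := has_sum_ge_partial A _ (has_sum_finite (fun i => `|f i| ^+ 2)).
by apply => i; exact: exprn_ge0.
Qed.

Definition vec (f : 'I_n -> H) : Hn := Ell2 (fin_square_summable f).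

Lemma vecE (f : 'I_n -> H) i : vec f i = f i. Proof. by []. Qed.

Lemma dot_vec (f g : Hn) : dot f g = \sum_i dot (f i) (g i).
Proof. exact: has_sum_unique (dot_ell2P f g) (has_sum_finite _). Qed.

Lemma norm_vec_le (f : Hn) : `|f| <= \sum_i `|f i|.
Proof.
have s0 : 0 <= \sum_i `|f i| by exact: sumr_ge0.
rewrite -(@ler_pXn2r _ 2) ?nnegrE// -dot_norm dot_vec expr2 mulr_suml.
apply: ler_sum => i _; rewrite dot_norm expr2 ler_wpM2l//.
by rewrite (bigD1 i)//= lerDl sumr_ge0.
Qed.
End Fin.

Section Tens.
Variable H : hilbertType C.
Local Notation Hn := (ell2 (fun _ : 'I_n => H)).
Implicit Types (M N : 'M[C]_n) (x y : bop H).

Definition mx_adj M : 'M[C]_n := \matrix_(i, j) (M j i)^*.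

Definition tens_fun M x (f : Hn) : Hn := vec (fun i => \sum_j M i j *: x (f j)).

Lemma tens_fun_adj M x f g : dot (tens_fun M x f) g = dot f (tens_fun (mx_adj M) (star x) g).
Proof.
rewrite !dot_vec.
under eq_bigr => i _ do rewrite vecE (form_suml (dot_inner_form H)).
rewrite exchange_big; apply: eq_bigr => j _ /=.
rewrite (form_sumr (dot_inner_form H)); apply: eq_bigr => i _.
by rewrite mxE dotZr conjCK dotZl bop_starE.
Qed.

Fact tens_subproof M x :
  (exists2 c : C, 0 <= c & opnorm_le (tens_fun M x) c) /\
  exists g : Hn -> Hn, forall f h, dot (tens_fun M x f) h = dot f (g h).
Proof.
split; last by exists (tens_fun (mx_adj M) (star x)); exact: tens_fun_adj.
exists (\sum_i \sum_j `|M i j| * `|x|) => [|f].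
  by rewrite sumr_ge0// => i _; rewrite sumr_ge0// => j _; rewrite mulr_ge0.
apply: le_trans (norm_vec_le _) _; rewrite mulr_suml; apply: ler_sum => i _.
rewrite mulr_suml; apply: le_trans (ler_norm_sum _ _ _) _.
apply: ler_sum => j _; rewrite normrZ -mulrA ler_wpM2l//.
apply: le_trans (bopE_norm_le _ _) _; rewrite ler_wpM2l//.
exact: (ell2_coord_le f).
Qed.

(** The operator [M (x) x] on [C^n (x) H], written on [H^n]. *)
Definition tens M x : bop Hn := Bop (tens_subproof M x).1 (tens_subproof M x).2.

Lemma tensE M x f i : tens M x f i = \sum_j M i j *: x (f j).
Proof. by []. Qed.

Lemma star_tens M x : star (tens M x) = tens (mx_adj M) (star x).
Proof. by apply: bop_star_unique => f g; exact: tens_fun_adj. Qed.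

Lemma tensM M N x y : (tens M x * tens N y)%g = tens (M *m N) (x * y)%g.
Proof.
apply: bop_eq => f; apply: ell2_eq => i; rewrite bop_mulE !tensE.
under eq_bigr do rewrite tensE bop_sum scaler_sumr.
rewrite exchange_big; apply: eq_bigr => k _ /=.
rewrite mxE scaler_suml; apply: eq_bigr => j _.
by rewrite bopZ scalerA.
Qed.

Lemma tens1 : tens 1%:M 1%g = 1%g.
Proof.
apply: bop_eq => f; apply: ell2_eq => i; rewrite tensE (bigD1 i)//= big1.
  by rewrite mxE eqxx scale1r addr0.
by move=> j ji; rewrite mxE eq_sym (negPf ji) scale0r.
Qed.

Lemma tens_linearr M : linear (tens M).
Proof.
move=> z x y; apply: bop_eq => f; apply: ell2_eq => i.
rewrite bop_addE bop_scaleE ell2_addE ell2_scaleE !tensE scaler_sumr -big_split.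
by apply: eq_bigr => j _; rewrite bop_addE bop_scaleE scalerDr !scalerA mulrC.
Qed.

Lemma tens_linearl x : linear (tens^~ x).
Proof.
move=> z M N; apply: bop_eq => f; apply: ell2_eq => i.
rewrite bop_addE bop_scaleE ell2_addE ell2_scaleE !tensE scaler_sumr -big_split.
by apply: eq_bigr => j _; rewrite !mxE scalerDl scalerA.
Qed.

(** [C^n] tensored with [H], realized as [H^n]. *)
Definition vec_tensor (h : ell2 (fun _ : 'I_n => cline R)) (l : H) : Hn :=
  vec (fun i => (h i : C) *: l).

Lemma vec_tensor_hilbert : hilbert_tensor vec_tensor.
Proof.
split.
- split=> [h z l m|l z h k]; apply: ell2_eq => i;
    rewrite ell2_addE ell2_scaleE !vecE.
    by rewrite scalerDr !scalerA mulrC.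
  by rewrite ell2_addE ell2_scaleE scalerDl -scalerA.
- move=> h k h' k'; rewrite !dot_vec mulr_suml; apply: eq_bigr => i _.
  by rewrite !vecE dotZl dotZr mulrA.
apply/dense_normP => f e e0; exists f; last by rewrite subrr normr0 ltW.
exists [seq (vec (fun j => ((i == j)%:R : C) : cline R), f i) | i <- enum 'I_n].
apply: ell2_eq => i; rewrite big_map big_enum /= ell2_sumE (bigD1 i)//=.
rewrite /= eqxx scale1r big1 ?addr0// => j ji.
by rewrite /= (negPf ji) scale0r.
Qed.

End Tens.

Lemma tens_vec_tensor (H : hilbertType C) (M : 'M[C]_n) (x : bop H) h (l : H) :
  tens M x (vec_tensor h l) = vec_tensor (tens M (1%g : bop (cline R)) h) (x l).
Proof.
apply: ell2_eq => i.
rewrite -[RHS]/((\sum_j M i j * (h j : C)) *: x l) tensE scaler_suml.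
by apply: eq_bigr => j _; rewrite bopZ scalerA.
Qed.

(** The components of an operator on [(\oplus_a K_a)^n] assembled from matrices
    and direct sums of operators. *)
Lemma tens_bdiagE (I : choiceType) (K : I -> hilbertType C) (M : 'M[C]_n)
    (x : forall a, bop (K a)) (xb : uniformly_bounded x)
    (f : ell2 (fun _ : 'I_n => ell2 K)) i a :
  tens M (bdiag xb) f i a = tens M (x a) (vec (fun j => f j a)) i.
Proof.
by rewrite !tensE ell2_sumE; apply: eq_bigr => j _; rewrite ell2_scaleE.
Qed.
End FiniteSum.

(** * The regular representation of a finite-dimensional C*-algebra *)

Section RealSpectrum.
Variables (C : numClosedFieldType) (n : nat) (A : 'M[C]_n).
Hypothesis real_eigen : forall (a : C) (v : 'rV[C]_n),
  v != 0 -> v *m A = a *: v -> a \is Num.real.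

Lemma real_spectrum_trig : exists P U : 'M[C]_n,
  [/\ P \in unitmx, is_trig_mx U, A = invmx P *m U *m P
    & forall i, U i i \is Num.real].
Proof.
(* [A] commutes with itself; this form of the Schur decomposition allows [n = 0]. *)
have [P Pu /andP[Ptrig _]] := cotrigonalization2 (erefl (A *m A)).
have Punit := unitarymx_unit Pu; pose U := conjmx P A.
have PA : P *m A = U *m P by apply/(similarP Punit); rewrite /similar_to /= eqxx.
exists P, U; split=> // [|i]; first by rewrite -mulmxA -PA mulKmx.
have : eigenvalue U (U i i).
  rewrite eigenvalue_root_char char_poly_trig// rootE horner_prod.
  by rewrite (bigD1 i)//= hornerXsubC subrr mul0r.
move=> /eigenvalueP[v vU v0]; apply: (real_eigen (v := v *m P)).
  apply: contra_neq v0 => vP; rewrite -[v](mulmxK Punit) vP mul0mx//.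
by rewrite -mulmxA PA mulmxA vU scalemxAl.
Qed.

(** In a triangular form [U] of [A] the diagonal carries the eigenvalues, so that
    [tr (A^2)] is the sum of their squares; if it vanishes then [U] is strictly
    triangular and [A] is nilpotent. *)
Lemma real_spectrum_trace :
  [/\ \tr A \is Num.real, 0 <= \tr (A *m A)
    & \tr (A *m A) = 0 -> forall v : 'rV[C]_n, iter n (fun u => u *m A) v = 0].
Proof.
have [P [U [Pu Ut AE Ur]]] := real_spectrum_trig.
have trU B : \tr (invmx P *m B *m P) = \tr B.
  by rewrite mxtrace_mulC mulmxA mulmxV ?mul1mx.
have AA : A *m A = invmx P *m (U *m U) *m P by rewrite AE !mulmxA mulmxK.
have trUU : \tr (U *m U) = \sum_i U i i ^+ 2.
  apply: eq_bigr => i _; rewrite mxE (bigD1 i)//= big1 ?addr0// => j ji.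
  have [ij|ij|ij] := ltngtP i j.
  - by rewrite (is_trig_mxP Ut _ _ ij) mul0r.
  - by rewrite (is_trig_mxP Ut _ _ ij) mulr0.
  - by move: ji; rewrite -val_eqE /= ij eqxx.
have sq0 i : 0 <= U i i ^+ 2 by rewrite -real_normK ?exprn_ge0.
rewrite AA {1}AE !trU trUU; split; [by rewrite rpred_sum | by rewrite sumr_ge0|].
move=> s0.
have U0 i : U i i = 0.
  by apply/eqP; rewrite -sqrf_eq0; apply/eqP/(psumr_eq0P _ s0).
have Un k (w : 'rV[C]_n) (j : 'I_n) : (n <= j + k)%N ->
    iter k (fun u => u *m U) w 0 j = 0.
  elim: k j => [|k IH] j; first by rewrite addn0 leqNgt ltn_ord.
  move=> njk; rewrite /= mxE big1// => i _.
  have [ij|ji|ij] := ltngtP i j.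
  - by rewrite (is_trig_mxP Ut _ _ ij) mulr0.
  - by rewrite IH ?mul0r//; apply: leq_trans njk _; rewrite addnS -addSn leq_add2r.
  - by rewrite (val_inj ij) U0 mulr0.
move=> v; have conj k : iter k (fun u => u *m A) v =
    iter k (fun u => u *m U) (v *m invmx P) *m P.
  elim: k => [|k IH] /=; first by rewrite mulmxKV.
  by rewrite IH AE !mulmxA mulmxK.
rewrite conj; suff -> : iter n (fun u => u *m U) (v *m invmx P) = 0 by rewrite mul0mx.
by apply/rowP => j; rewrite Un ?mxE// leq_addl.
Qed.
End RealSpectrum.

Section Coordinates.
Variables (C : numClosedFieldType) (V : lmodType C).

(** As long as there is a nontrivial relation, a vector can be dropped. *)
Lemma independent_spanning_family : finite_dimensional V ->
  exists (n : nat) (e : 'I_n -> V),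
    (forall v, exists c : 'I_n -> C, v = \sum_i c i *: e i) /\
    (forall c : 'I_n -> C, \sum_i c i *: e i = 0 -> forall i, c i = 0).
Proof.
move=> [n [e espan]]; elim: n e espan => [|n IH] e espan.
  by exists 0%N, e; split=> // c _ [].
have [ind|/existsNP[c /not_implyP[ce0 /existsNP[k /eqP ck]]]] :=
    pselect (forall c : 'I_n.+1 -> C, \sum_i c i *: e i = 0 -> forall i, c i = 0).
  by exists n.+1, e.
apply: (IH (e \o lift k)) => v; have [a ->] := espan v.
exists (fun j => a (lift k j) - a k / c k * c (lift k j)).
have ek : e k = - \sum_j (c (lift k j) / c k) *: e (lift k j).
  move/eqP: ce0; rewrite (bigD1_ord k)//= addr_eq0 => /eqP ce0.
  rewrite -[LHS](scalerK ck) ce0 scalerN scaler_sumr; congr (- _).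
  by apply: eq_bigr => j _; rewrite scalerA mulrC.
rewrite (bigD1_ord k)//= ek scalerN scaler_sumr addrC -sumrB.
apply: eq_bigr => j _; rewrite /= scalerA scalerBl; congr (_ - _ *: _).
by ring.
Qed.

Lemma exists_coordinates : finite_dimensional V ->
  exists (n : nat) (e : 'I_n -> V) (crd : V -> 'rV[C]_n),
    (forall v, v = \sum_i crd v 0 i *: e i) /\
    (forall c : 'rV[C]_n, crd (\sum_i c 0 i *: e i) = c).
Proof.
move=> /independent_spanning_family[n [e [espan eind]]].
have /choice[crd hcrd] : forall v, exists c : 'rV[C]_n, v = \sum_i c 0 i *: e i.
  move=> v; have [c ->] := espan v; exists (\row_i c i).
  by apply: eq_bigr => i _; rewrite mxE.
exists n, e, crd; split=> // c; apply/rowP => i; apply/eqP.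
rewrite -subr_eq0; apply/eqP/(eind (fun i => crd (\sum_i c 0 i *: e i) 0 i - c 0 i)).
under eq_bigr do rewrite scalerBl.
by rewrite sumrB -hcrd subrr.
Qed.
End Coordinates.

(** A maximal orthonormal family spans, and its size is bounded by the number of
    vectors of a spanning family. *)
Lemma orthonormal_basis (C : numClosedFieldType) (V : lmodType C)
    (d : V -> V -> C) : finite_dimensional V -> inner_form d ->
  exists (n : nat) (e : 'I_n -> V),
    (forall i j, d (e i) (e j) = (i == j)%:R) /\
    (forall v, v = \sum_i d v (e i) *: e i).
Proof.
move=> /exists_coordinates[N [f [crd [fcrd _]]]] hd.
pose P n := `[< exists e : 'I_n -> V, forall i j, d (e i) (e j) = (i == j)%:R >].
have P0 : P 0%N by apply/asboolP; exists (fun=> 0) => -[].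
have bound n : P n -> (n <= N)%N.
  move=> /asboolP[e eo]; rewrite leqNgt; apply/negP => Nn.
  pose A : 'M[C]_(n, N) := \matrix_(i, j) crd (e i) 0 j.
  have /rowV0Pn[w /sub_kermxP wA w0] : kermx A != 0.
    rewrite -mxrank_eq0 mxrank_ker subn_eq0 -ltnNge.
    exact: leq_ltn_trans (rank_leq_col A) Nn.
  have we : \sum_i w 0 i *: e i = 0.
    under eq_bigr => i _ do rewrite (fcrd (e i)) scaler_sumr.
    rewrite exchange_big big1// => j _.
    have h : \sum_i w 0 i * crd (e i) 0 j = 0.
      transitivity ((w *m A) 0 j); last by rewrite wA mxE.
      by rewrite mxE; apply: eq_bigr => i _; rewrite mxE.
    under eq_bigr do rewrite scalerA.
    by rewrite -scaler_suml h scale0r.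
  case/negP: w0; apply/eqP/rowP => k; rewrite mxE.
  have := congr1 (fun v => d v (e k)) we; rewrite (form_suml hd) (form0l hd).
  rewrite (bigD1 k)//= big1 ?addr0 => [|i ik]; rewrite (formZl hd) eo.
    by rewrite eqxx mulr1.
  by rewrite (negPf ik) mulr0.
have [n /asboolP[e eo] nmax] := ex_maxnP (ex_intro (fun n => P n) 0%N P0) bound.
exists n, e; split=> // v.
pose w := v - \sum_i d v (e i) *: e i.
have we k : d w (e k) = 0.
  rewrite (formBl hd) (form_suml hd) (bigD1 k)//= big1 ?addr0 => [|i ik];
    rewrite (formZl hd) eo; first by rewrite eqxx mulr1 subrr.
  by rewrite (negPf ik) mulr0.
have [w0|w0] := eqVneq w 0; first by apply/eqP; rewrite -subr_eq0 -/w w0.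
have nw : form_norm d w != 0 by apply: contra_neq w0; exact: form_norm_eq0.
pose u := (form_norm d w)^-1 *: w.
have : P n.+1.
  apply/asboolP; exists (fun i => oapp e u (unlift ord_max i)) => i j.
  have uu : d u u = 1.
    have nc : ((form_norm d w)^-1)^* = (form_norm d w)^-1.
      by apply/CrealP/ger0_real; rewrite invr_ge0 form_norm_ge0.
    rewrite (formZl hd) (formZr hd) nc.
    have <- : form_norm d w ^+ 2 = d w w by exact: sqrtCK.
    by rewrite expr2 mulKf// mulVf.
  have ue k : d u (e k) = 0 by rewrite (formZl hd) we mulr0.
  case: unliftP => [i'|] ->; case: unliftP => [j'|] -> /=.
  - by rewrite eo (inj_eq lift_inj).
  - by rewrite (form_conj hd) ue conjC0 eq_sym (negPf (neq_lift _ _)).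
  - by rewrite ue (negPf (neq_lift _ _)).
  - by rewrite uu eqxx.
by move/nmax; rewrite ltnn.
Qed.

Section RegularRepresentation.
Variables (R : realType) (X : cstarAlgType R[i]).
Local Notation C := R[i].
Hypothesis Xfin : finite_dimensional X.

(** The form is [<a, b> = tr (L (b^* a))], with [L] the left multiplication.
    Positivity costs nothing more than the reality of the spectra of self-adjoint
    elements, because the trace does not distinguish [a^* a] from [a a^*]: for
    [a = x + i y] this gives [tr (L (a^* a)) = tr (L (x^2)) + tr (L (y^2))]. *)
Lemma trace_form : exists d : X -> X -> C, inner_form d /\
  forall a b c, d (a * b)%g c = d b (star a * c)%g.
Proof.
have [n [e [crd [ecrd crde]]]] := exists_coordinates Xfin.
have crdZD z a b : crd (z *: a + b) = z *: crd a + crd b.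
  rewrite -[RHS]crde [in LHS](ecrd a) [in LHS](ecrd b) scaler_sumr -big_split /=.
  by congr crd; apply: eq_bigr => i _; rewrite !mxE scalerDl scalerA.
have crd0 : crd 0 = 0.
  by rewrite -[RHS]crde; congr crd; rewrite big1// => i _; rewrite mxE scale0r.
have crd_inj a b : crd a = crd b -> a = b by rewrite {2}(ecrd a) {2}(ecrd b) => ->.
pose L (a : X) : 'M[C]_n := \matrix_i crd (a * e i)%g.
have Lcrd (a v : X) : crd (a * v)%g = crd v *m L a.
  rewrite [in LHS](ecrd v) cstar_mul_sumr mulmx_sum_row.
  have crd_sum (F : 'I_n -> X) : crd (\sum_i F i) = \sum_i crd (F i).
    apply: (big_morph crd) => // a' b'.
    by have := crdZD 1 a' b'; rewrite !scale1r.
  rewrite crd_sum; apply: eq_bigr => i _.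
  by rewrite -cstar_scaleAr -[X in crd X]addr0 crdZD crd0 addr0 rowK.
have LM (a b : X) : L (a * b)%g = L b *m L a.
  by apply/row_matrixP => i; rewrite row_mul !rowK -mulgA [LHS]Lcrd.
have LZD z a b : L (z *: a + b) = z *: L a + L b.
  apply/row_matrixP => i; rewrite linearP /= !rowK.
  by rewrite cstar_mulDl -cstar_scaleAl crdZD.
pose t (a : X) : C := \tr (L a).
have tZD z a b : t (z *: a + b) = z * t a + t b by rewrite /t LZD linearP.
have tC (a b : X) : t (a * b)%g = t (b * a)%g by rewrite /t !LM mxtrace_mulC.
(* For an eigenvector [w] of [L x], both [a w^* w] and its adjoint equal
   [w^* x w]. *)
have real_eigen (x : X) : star x = x -> forall (a : C) (v : 'rV[C]_n),
    v != 0 -> v *m L x = a *: v -> a \is Num.real.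
  move=> sx a v v0 va; pose w := \sum_i v 0 i *: e i.
  have vw : v = crd w by rewrite crde.
  have xw : (x * w)%g = a *: w.
    by apply: crd_inj; rewrite Lcrd -vw va -[a *: w]addr0 crdZD crd0 addr0 -vw.
  have w0 : (star w * w)%g != 0.
    rewrite -normr_eq0 cstar_norm_star sqrf_eq0 normr_eq0.
    by apply: contra_neq v0; rewrite vw => ->.
  have h1 : (star w * (x * w))%g = a *: (star w * w)%g by rewrite xw cstar_scaleAr.
  have h2 : (star w * (x * w))%g = a^* *: (star w * w)%g.
    have := congr1 star h1; rewrite cstar_starZ !cstar_starM cstar_starK sx => <-.
    by rewrite mulgA.
  apply/CrealP/eqP; rewrite -subr_eq0; apply/eqP.
  have : (a^* - a) *: (star w * w)%g = 0 by rewrite scalerBl -h1 -h2 subrr.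
  by move/eqP; rewrite scaler_eq0 (negPf w0) orbF => /eqP.
(* If [tr (L (x^2)) = 0] then [L x] is nilpotent, hence so is [x], and the C*-identity
   leaves only [x = 0]. *)
have t_self (x : X) : star x = x -> [/\ t x \is Num.real, 0 <= t (x * x)%g
    & t (x * x)%g = 0 -> x = 0].
  move=> sx; have [h1 h2 h3] := real_spectrum_trace (real_eigen x sx).
  split=> //; rewrite /t LM// => /h3 Ln.
  have crdsq k v : crd (iter k (fun y => y * y) x * v)%g =
      iter (2 ^ k) (fun u => u *m L x) (crd v).
    elim: k v => [|k IH] v; first by rewrite /= Lcrd.
    by rewrite /= -mulgA !IH -iterD addnn -mul2n -expnS.
  have : iter n (fun y => y * y)%g x = 0.
    apply: crd_inj; rewrite -[iter n _ x]mulg1 crdsq crd0.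
    rewrite -(subnK (ltnW (ltn_expl n (ltnSn 1)))) iterD Ln.
    by elim: (2 ^ n - n)%N => //= k ->; rewrite mul0mx.
  move/(congr1 (fun y => `|y|)); rewrite norm_iter_sq// normr0 => /eqP.
  by rewrite expf_eq0 normr_eq0 => /andP[_ /eqP].
have cartesian (a : X) : exists h k : X,
    [/\ star h = h, star k = k & a = h + 'i *: k].
  exists (2^-1 *: (a + star a)), ((2 * 'i)^-1 *: (a - star a)).
  rewrite !cstar_starZ starB cstar_starD !cstar_starK !fmorphV rmorphM /= conjCi.
  rewrite rmorph_nat [star a + a]addrC; split=> //.
    by rewrite mulrN invrN scaleNr -scalerN opprB.
  rewrite scalerA invfM mulrCA mulfV ?neq0Ci// mulr1 -scalerDr addrACA subrr addr0.
  by rewrite -mulr2n -(scaler_nat 2 a) scalerA mulVf ?scale1r ?pnatr_eq0.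
have t0 : t 0 = 0.
  have := tZD 1 0 0; rewrite scaler0 addr0 mul1r => h.
  by apply: (addrI (t 0)); rewrite -h addr0.
have tZ z a : t (z *: a) = z * t a by have := tZD z a 0; rewrite !addr0 t0 addr0.
have tD a b : t (a + b) = t a + t b by have := tZD 1 a b; rewrite scale1r mul1r.
have t_star a : t (star a) = (t a)^*.
  have [h [k [sh sk ->]]] := cartesian a.
  have [ht _ _] := t_self h sh; have [kt _ _] := t_self k sk.
  rewrite cstar_starD cstar_starZ sh sk !tD !tZ rmorphD rmorphM /= conjCi.
  by rewrite (CrealP ht) (CrealP kt).
have t_sq h k : star h = h -> star k = k ->
    t (star (h + 'i *: k) * (h + 'i *: k))%g = t (h * h)%g + t (k * k)%g.
  move=> sh sk; rewrite cstar_starD cstar_starZ sh sk conjCi.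
  rewrite cstar_mulDl !cstar_mulDr -!cstar_scaleAl -!cstar_scaleAr scalerA.
  rewrite mulNr -expr2 sqrCi opprK scale1r !tD !tZ (tC k h).
  by rewrite mulNr addrA addrK.
exists (fun a b => t (star b * a)%g); split; last first.
  by move=> a b c; rewrite cstar_starM cstar_starK mulgA.
split=> [z a b c|a b|a|a].
- by rewrite cstar_mulDr -cstar_scaleAr tZD.
- by rewrite -t_star cstar_starM cstar_starK.
- have [h [k [sh sk ->]]] := cartesian a; rewrite t_sq//.
  have [_ h0 _] := t_self h sh; have [_ k0 _] := t_self k sk.
  exact: addr_ge0.
have [h [k [sh sk ->]]] := cartesian a; rewrite t_sq//.
have [_ h0 hh] := t_self h sh; have [_ k0 kk] := t_self k sk.
move/eqP; rewrite paddr_eq0// => /andP[/eqP/hh -> /eqP/kk ->].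
by rewrite scaler0 addr0.
Qed.

Definition regular_matrices n (e : 'I_n -> X) (p : X -> 'M[C]_n)
    (u : 'I_n -> C) : Prop :=
  [/\ linear p, forall a b, p (a * b)%g = p a *m p b, p 1%g = 1%:M
    & forall a, p (star a) = mx_adj (p a)] /\
  [/\ forall a, a = \sum_i (\sum_j p a i j * u j) *: e i
    & forall k i, \sum_j p (e k) i j * u j = (i == k)%:R].

(** The matrices of the left multiplications in an orthonormal basis [e] of the
    trace form; [u] lists the coordinates of the unit, so that [p a u] lists
    those of [a]. *)
Lemma regular_matrices_exist : exists n (e : 'I_n -> X) p u, regular_matrices e p u.
Proof.
have [d [hd dM]] := trace_form; have [n [e [eo ed]]] := orthonormal_basis Xfin hd.
exists n, e, (fun a => \matrix_(i, j) d (a * e j)%g (e i)), (fun j => d 1%g (e j)).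
have pu a i : \sum_j (\matrix_(i, j) d (a * e j)%g (e i)) i j * d 1%g (e j) = d a (e i).
  rewrite -[a in RHS]mulg1 [X in (a * X)%g]ed cstar_mul_sumr (form_suml hd).
  by apply: eq_bigr => j _; rewrite mxE -cstar_scaleAr (formZl hd) mulrC.
split; split.
- move=> z a b; apply/matrixP => i j.
  by rewrite !mxE cstar_mulDl -cstar_scaleAl (formDl hd) (formZl hd).
- move=> a b; apply/matrixP => i j; rewrite !mxE -mulgA.
  rewrite [X in d (a * X)%g _](ed (b * e j)%g) cstar_mul_sumr (form_suml hd).
  by apply: eq_bigr => k _; rewrite !mxE -cstar_scaleAr (formZl hd) mulrC.
- by apply/matrixP => i j; rewrite !mxE mul1g eo eq_sym.
- move=> a; apply/matrixP => i j; rewrite !mxE.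
  by rewrite dM cstar_starK (form_conj hd).
- by move=> a; under eq_bigr do rewrite pu; exact: ed.
by move=> k i; rewrite pu eo eq_sym.
Qed.

Section Faithful.
Variables (n : nat) (e : 'I_n -> X) (p : X -> 'M[C]_n) (u : 'I_n -> C).
Hypothesis hp : regular_matrices e p u.

Lemma regular_linear z a b : p (z *: a + b) = z *: p a + p b.
Proof. by case: hp => [[pl _ _ _] _]; exact: pl. Qed.

Lemma regularM a b : p (a * b)%g = p a *m p b.
Proof. by case: hp => [[]]. Qed.

Lemma regular1 : p 1%g = 1%:M. Proof. by case: hp => [[]]. Qed.

Lemma regular_star a : p (star a) = mx_adj (p a).
Proof. by case: hp => [[]]. Qed.

Lemma regular_coord a : a = \sum_i (\sum_j p a i j * u j) *: e i.
Proof. by case: hp => _ []. Qed.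

Lemma regular_basis k i : \sum_j p (e k) i j * u j = (i == k)%:R.
Proof. by case: hp => _ []. Qed.

Definition regular_rep (a : X) : bop (ell2 (fun _ : 'I_n => cline R)) :=
  tens (p a) 1%g.

Lemma regular_rep_star_hom : star_hom regular_rep.
Proof.
split=> [z a b|a b||a]; rewrite /regular_rep.
- by rewrite regular_linear tens_linearl.
- by rewrite regularM tensM mulg1.
- by rewrite regular1 tens1.
- by rewrite regular_star star_tens star1.
Qed.

Lemma regular_coord_le a i : `|\sum_j p a i j * u j| <=
  `|regular_rep a| * `|vec (u : 'I_n -> cline R)|.
Proof.
by apply: le_trans (bopE_norm_le _ _); exact: (ell2_coord_le (regular_rep a _) i).
Qed.

(** The vector [p a u] lists the coordinates of [a], so that [|a|] is at most a constant
    times the norm of [regular_rep a]; the constant must then be 1. *)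
Lemma regular_rep_isometric a : `|regular_rep a| = `|a|.
Proof.
apply: (star_hom_isometric
  (k := (\sum_i `|e i|) * `|vec (u : 'I_n -> cline R)|) regular_rep_star_hom) => b.
rewrite {1}(regular_coord b); apply: le_trans (ler_norm_sum _ _ _) _.
rewrite -mulrA mulr_suml; apply: ler_sum => i _.
by rewrite normrZ mulrC ler_wpM2l// mulrC regular_coord_le.
Qed.

End Faithful.
End RegularRepresentation.

(** * Representations and minimal tensor products *)

Section Representations.
Variables (R : realType).
Local Notation C := R[i].

Lemma faithful_rep_bop (A : cstarAlgType C) (H : hilbertType C) (pi : A -> H -> H) :
  faithful_rep pi -> exists f : A -> bop H,
    [/\ star_hom f, forall a, `|f a| = `|a| & forall a h, f a h = pi a h].
Proof.
move=> [[pib pil piM pi1 pis] pin].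
have bnd a : exists2 c : C, 0 <= c & opnorm_le (pi a) c.
  have [_ [c hc]] := pib a; exists `|c| => // x; apply: le_trans (hc x) _.
  rewrite -[X in X <= _]ger0_norm ?normrM ?normr_id//.
  exact: le_trans (hc x).
pose f a : bop H := Bop (bnd a) (ex_intro _ (pi (star a)) (pis a)).
exists f; split=> // [|a].
  split=> [c a b|a b||a].
  - by apply: bop_eq => h; exact: pil.
  - by apply: bop_eq => h; exact: piM.
  - by apply: bop_eq => h; exact: pi1.
  - by symmetry; apply: bop_star_unique => x y; exact: pis.
apply/eqP; rewrite eq_le; apply/andP; split.
  by apply/bop_norm_leP => //; apply/(pin a) => //; rewrite lexx.
by apply/pin => //; apply/(bop_norm_leP (f a)).
Qed.

Lemma faithful_rep_of_isometric (A : cstarAlgType C) (H : hilbertType C) (f : A -> bop H) :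
  star_hom f -> (forall a, `|f a| = `|a|) -> faithful_rep (fun a => f a : H -> H).
Proof.
move=> hf fn; split; last by move=> a c c0; rewrite -fn; exact: bop_norm_leP.
split=> [a|c a b h|a b h|h|a h k].
- split; first by move=> c x y; exact: bopZD.
  by have [c _ hc] := bop_bounded (f a); exists c.
- by rewrite (star_homZD hf).
- by rewrite (star_homM hf).
- by rewrite (star_hom1 hf).
- by rewrite (star_hom_star hf) bop_starE.
Qed.

(** Bilinear maps inducing a unital *-homomorphism on the algebraic tensor
    product. *)
Definition tensor_compatible (A B S : cstarAlgType C) (t : A -> B -> S) : Prop :=
  [/\ bilinear_map t,
      forall a b a' b', (t a b * t a' b')%g = t (a * a')%g (b * b')%g,
      t 1%g 1%g = 1%g
    & forall a b, star (t a b) = t (star a) (star b)].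

Section HilbertTensor.
Variables (H K L : hilbertType C) (th : H -> K -> L).
Hypothesis hth : hilbert_tensor th.

Lemma hilbert_tensor_ext (x y : L) :
  (forall h k, dot x (th h k) = dot y (th h k)) -> x = y.
Proof.
case: hth => _ _ /dense_normP thd xy.
pose w := x - y; have w0 h k : dot w (th h k) = 0 by rewrite dotBl xy subrr.
apply/eqP; rewrite -subr_eq0 -/w -normr_le0; apply/ler_addgt0Pr => e e0.
rewrite add0r; have [l [s ->] wl] := thd w e e0.
have [->|wn0] := eqVneq w 0; first by rewrite normr0 ltW.
have wp : 0 < `|w| by rewrite normr_gt0.
have : `|w| ^+ 2 <= `|w| * e.
  rewrite -dot_norm -[X in dot _ X](subrK (\sum_(p <- s) th p.1 p.2)) dotDr.
  rewrite (form_sumr (dot_inner_form L)) [X in _ + X]big1 ?addr0//.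
  rewrite -[X in X <= _]ger0_norm; last first.
    have -> : dot w (w - \sum_(p <- s) th p.1 p.2) = `|w| ^+ 2.
      rewrite dotBr (form_sumr (dot_inner_form L)) [X in _ - X]big1 ?subr0 ?dot_norm//.
    exact: exprn_ge0.
  by apply: le_trans (cauchy_schwarz _ _) _; rewrite ler_wpM2l.
by rewrite expr2 ler_pM2l.
Qed.

Lemma hilbert_tensor_bop_ext (F G : bop L) :
  (forall h k, F (th h k) = G (th h k)) -> F = G.
Proof.
move=> FG; apply: bop_eq => l; apply: dot_extl => y; rewrite !bop_starE.
congr dot; apply: hilbert_tensor_ext => h k.
by rewrite dot_conj -bop_starE FG bop_starE -dot_conj.
Qed.

Lemma norm_hilbert_tensor h k : `|th h k| = `|h| * `|k|.
Proof.
case: hth => _ thd _; apply/eqP; rewrite -(@eqrXn2 _ 2) ?mulr_ge0//.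
by rewrite -dot_norm thd exprMn !dot_norm.
Qed.
End HilbertTensor.
End Representations.

Section MinTensor.
Variables (R : realType).
Local Notation C := R[i].
Variables (X : cstarAlgType C) (n : nat) (e : 'I_n -> X) (p : X -> 'M[C]_n)
  (u : 'I_n -> C).
Hypothesis hp : regular_matrices e p u.
Variables (D S : cstarAlgType C) (t : X -> D -> S).
Hypothesis ht : min_tensor t.

(** The relations hold between operators on the Hilbert space tensor product, where
    they need only be tested on elementary tensors. *)
Lemma min_tensor_compatible : tensor_compatible t.
Proof.
case: ht => tb [H [K [L [th [pi [rho [sigma
  [[hth /faithful_rep_bop[f [hf fn fE]] /faithful_rep_bop[g [hg gn gE]]
   /faithful_rep_bop[s [hs sn sE]]] [tE _]]]]]]]]].
have stE a b h k : s (t a b) (th h k) = th (f a h) (g b k).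
  by rewrite sE tE fE gE.
have s_inj x y : s x = s y -> x = y.
  move=> xy; apply/eqP; rewrite -subr_eq0 -normr_eq0 -sn (star_homB hs).
  by rewrite xy subrr normr0.
split=> // [a b a' b'||a b]; apply: s_inj; apply: (hilbert_tensor_bop_ext hth) => h k.
- by rewrite (star_homM hs) stE bop_mulE !stE (star_homM hf) (star_homM hg).
- by rewrite stE (star_hom1 hf) (star_hom1 hg) (star_hom1 hs).
rewrite (star_hom_star hs) stE; apply: (hilbert_tensor_ext hth) => h' k'.
have thd := let: And3 _ x _ := hth in x.
rewrite -[star (s _)]/(bop_star _) dot_conj -bop_starE stE thd [RHS]thd rmorphM /= -!dot_conj.
by rewrite (star_hom_star hf) (star_hom_star hg) 
  [dot (star (f a) _) _]bop_starE [dot (star (g b) _) _]bop_starE !bop_starK.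
Qed.

Lemma min_tensor_dense : dense [set x | exists s : seq (X * D), x = \sum_(q <- s) t q.1 q.2].
Proof.
by case: ht => _ [? [? [? [? [? [? [? [_ [_ td]]]]]]]]].
Qed.

Lemma regular_coord_sum (c : 'I_n -> C) i :
  \sum_j p (\sum_k c k *: e k) i j * u j = c i.
Proof.
pose c_i (a : X) : C^o := \sum_j p a i j * u j.
have cl : linear c_i.
  move=> z a b; rewrite /c_i scaler_sumr -big_split /=; apply: eq_bigr => j _.
  by rewrite (regular_linear hp) !mxE mulrDl -mulrA.
have ce k : c_i (e k) = (i == k)%:R by exact: (regular_basis hp).
rewrite -[LHS]/(c_i _) (lin_sum cl) (bigD1 i)//= big1 => [|k ki].
  by rewrite addr0 (linZ cl) ce eqxx [LHS]mulr1.
by rewrite (linZ cl) ce eq_sym (negPf ki) [LHS]mulr0.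
Qed.

(** For [s = \sum_i t (e i) (d i)] and vectors [k], [k'] of the space on which [D]
    acts, the element [x = \sum_i <d_i k, k'> e_i] of [X] satisfies
    [<x h, h'> = <s (h (x) k), h' (x) k'>] for all [h], [h'], so that
    [|x| <= |s| |k| |k'|], which bounds its coordinates. *)
Lemma coef_le (d : 'I_n -> D) i :
  `|d i| <= `|vec (u : 'I_n -> cline R)| * `|\sum_i t (e i) (d i)|.
Proof.
case: ht => tb [H [K [L [th [pi [rho [sigma
  [[hth /faithful_rep_bop[f [hf fn fE]] /faithful_rep_bop[g [hg gn gE]]
   /faithful_rep_bop[s [hs sn sE]]] [tE _]]]]]]]]].
have stE a b h k : s (t a b) (th h k) = th (f a h) (g b k).
  by rewrite sE tE fE gE.
have [_ thd _] := hth.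
set U := `|vec _|; set T := \sum_i _; have U0 : 0 <= U := normr_ge0 _.
rewrite -gn; apply/bop_norm_leP => [|k]; first by rewrite mulr_ge0.
apply: norm_le_of_dot => [|k']; first by rewrite !mulr_ge0.
pose x := \sum_j dot (g (d j) k) k' *: e j.
have xh h h' : dot (f x h) h' = dot (s T (th h k)) (th h' k').
  rewrite (star_hom_sum hs) (star_hom_sum hf) !bop_sumE.
  rewrite (form_suml (dot_inner_form H)) (form_suml (dot_inner_form L)).
  apply: eq_bigr => j _.
  by rewrite (star_homZ hf) bop_scaleE dotZl stE thd mulrC.
have xT : `|x| <= `|T| * `|k| * `|k'|.
  rewrite -fn; apply/bop_norm_leP => [|h]; first by rewrite !mulr_ge0.
  apply: norm_le_of_dot => [|h']; first by rewrite !mulr_ge0.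
  rewrite xh; apply: le_trans (cauchy_schwarz _ _) _.
  rewrite (norm_hilbert_tensor hth).
  apply: (@le_trans _ _ (`|T| * (`|h| * `|k|) * (`|h'| * `|k'|))).
    rewrite ler_wpM2r ?mulr_ge0// -(norm_hilbert_tensor hth) -sn.
    exact: bopE_norm_le.
  by rewrite le_eqVlt; apply/orP; left; apply/eqP; ring.
have <- : \sum_j p x i j * u j = dot (g (d i) k) k' by exact: regular_coord_sum.
apply: le_trans (regular_coord_le p u x i) _; rewrite (regular_rep_isometric hp).
have -> : U * `|T| * `|k| * `|k'| = (`|T| * `|k| * `|k'|) * U by ring.
by rewrite ler_wpM2r.
Qed.

Lemma coef_unique (d d' : 'I_n -> D) :
  \sum_i t (e i) (d i) = \sum_i t (e i) (d' i) -> d =1 d'.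
Proof.
move=> dd i; have [[tl _] _ _ _] := min_tensor_compatible.
apply/eqP; rewrite -subr_eq0 -normr_le0.
have := coef_le (fun i => d i - d' i) i.
under eq_bigr do rewrite (linB (tl _)).
by rewrite sumrB dd subrr normr0 mulr0.
Qed.

(** Finite sums of elementary tensors have this form, and it persists in the limit
    because the coefficients depend continuously on the sum. *)
Lemma coef_exists (s : S) : exists d : 'I_n -> D, s = \sum_i t (e i) (d i).
Proof.
have [[tl tr] tM t1 ts] := min_tensor_compatible.
have t_crd a b : t a b = \sum_i t (e i) ((\sum_j p a i j * u j) *: b).
  rewrite [in LHS](regular_coord hp a) (lin_sum (tr b)); apply: eq_bigr => i _.
  by rewrite (linZ (tr b)) (linZ (tl _)).
have finite_sum (q : seq (X * D)) : exists d : 'I_n -> D,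
    \sum_(r <- q) t r.1 r.2 = \sum_i t (e i) (d i).
  elim: q => [|r q [d IH]].
    by exists (fun=> 0); rewrite big_nil big1// => i _; rewrite (lin0 (tl _)).
  exists (fun i => (\sum_j p r.1 i j * u j) *: r.2 + d i).
  rewrite big_cons t_crd IH -big_split; apply: eq_bigr => i _ /=.
  by rewrite (linD (tl _)).
have /dense_normP td := min_tensor_dense.
have /choice[d hd] : forall m : nat, exists d : 'I_n -> D,
    `|s - \sum_i t (e i) (d i)| <= m.+1%:R^-1.
  move=> m; have m0 : 0 < m.+1%:R^-1 :> C by rewrite invr_gt0 ltr0Sn.
  have [_ [q ->]] := td s _ m0; have [d ->] := finite_sum q.
  by exists d.
pose T (d : 'I_n -> D) := \sum_i t (e i) (d i).
have TB (a b : 'I_n -> D) : T a - T b = T (fun i => a i - b i).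
  by rewrite /T -sumrB; apply: eq_bigr => i _; rewrite (linB (tl _)).
have Td : cvg_seq (fun m => T (d m)) s.
  move=> r r0; have [N hN] := exists_invS_le r0; exists N => m Nm.
  rewrite distrC; apply: le_trans (hd m) (le_trans _ hN).
  by rewrite lef_pV2 ?posrE ?ltr0Sn// ler_nat.
have /choice[l hl] : forall i, exists l, cvg_seq (fun m => d m i) l.
  move=> i; apply: cauchy_seq_cvg.
  apply: (cauchy_seq_sub (u := fun m => T (d m)) (normr_ge0 (vec (u : 'I_n -> cline R)))).
    by move=> m m'; rewrite TB; exact: (coef_le (fun i => d m i - d m' i)).
  exact: cvg_seq_cauchy Td.
exists l; apply: cvg_seq_unique Td _; apply: cvg_seq_sum => i.
apply: (cvg_seq_dominated (normr_ge0 (t (e i) 1%g)) _ (hl i)) => m.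
have h1 : star_hom (t 1%g).
  by split=> [z a b|a b||a]; rewrite ?tl ?tM ?ts ?mul1g ?star1.
rewrite -(linB (tl _)) -[e i in X in X <= _]mulg1 -[_ - _ in X in X <= _]mul1g -tM.
by apply: le_trans (cstar_normM _ _) _; rewrite ler_wpM2l// star_hom_contractive.
Qed.

Definition coef (s : S) : 'I_n -> D := projT1 (cid (coef_exists s)).

Lemma coefE s : s = \sum_i t (e i) (coef s i).
Proof. exact: (projT2 (cid (coef_exists s))). Qed.

Lemma coef_sum (d : 'I_n -> D) i : coef (\sum_i t (e i) (d i)) i = d i.
Proof. by apply: coef_unique; rewrite -coefE. Qed.

(** By the two preceding properties [S] is the algebraic tensor product of [X] and
    [D]. *)
Lemma tensor_extension (B : cstarAlgType C) (b : X -> D -> B) :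
  tensor_compatible b ->
  exists m : S -> B, star_hom m /\ forall x d, m (t x d) = b x d.
Proof.
move=> [[bl br] bM b1 bs]; have [[tl tr] tM t1 ts] := min_tensor_compatible.
pose m s := \sum_i b (e i) (coef s i).
have mt x d : m (t x d) = b x d.
  have -> : t x d = \sum_i t (e i) ((\sum_j p x i j * u j) *: d).
    rewrite [in LHS](regular_coord hp x) (lin_sum (tr d)); apply: eq_bigr => i _.
    by rewrite (linZ (tr d)) (linZ (tl _)).
  rewrite /m; under eq_bigr do rewrite coef_sum.
  rewrite [in RHS](regular_coord hp x) (lin_sum (br d)); apply: eq_bigr => i _.
  by rewrite (linZ (br d)) (linZ (bl _)).
have ml : linear m.
  move=> z s s'; rewrite /m scaler_sumr -big_split; apply: eq_bigr => i _ /=.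
  rewrite -bl; congr b; rewrite {1}(coefE s) {1}(coefE s') scaler_sumr -big_split /=.
  by under eq_bigr do rewrite -tl; rewrite coef_sum.
exists m; split=> //; split=> // [s s'||s]; last 2 first.
- by rewrite -t1 mt.
- rewrite {1}(coefE s) star_sum (lin_sum ml) star_sum; apply: eq_bigr => i _.
  by rewrite ts mt bs.
rewrite {1}(coefE s) {1}(coefE s') cstar_mul_suml (lin_sum ml) cstar_mul_suml.
apply: eq_bigr => i _; rewrite !cstar_mul_sumr (lin_sum ml).
by apply: eq_bigr => j _; rewrite tM mt bM.
Qed.

End MinTensor.

Section Single.
Variables (R : realType) (I : choiceType).
Local Notation C := R[i].
Variable H : I -> hilbertType C.

Lemma sum_single (A : {fset I}) (F : I -> C) a : (forall i, i != a -> F i = 0) ->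
  \sum_(i <- A) F i = if a \in A then F a else 0.
Proof.
move=> Fa; case: ifP => aA; last first.
  by rewrite big_seq big1// => i iA; apply: Fa; apply: contraFneq aA => <-.
by rewrite (bigD1_seq a) ?fset_uniq//= big1 ?addr0.
Qed.

Fact single_square_summable a (v : H a) :
  square_summable (dfwith (fun i => 0 : H i) v).
Proof.
exists (`|v| ^+ 2) => A; rewrite (@sum_single _ _ a) => [|i ia].
  by case: ifP => _; [rewrite dfwith_in lexx | exact: exprn_ge0].
by rewrite dfwith_out 1?eq_sym// normr0 expr0n.
Qed.

Definition single a (v : H a) : ell2 H := Ell2 (single_square_summable v).

Lemma singleE a (v : H a) : single v a = v.
Proof. exact: dfwith_in. Qed.

Lemma dot_single a (v : H a) (g : ell2 H) : dot (single v) g = dot v (g a).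
Proof.
apply: has_sum_unique (dot_ell2P _ _) _ => r r0.
exists [fset a]%fset => B; rewrite fsub1set => aB.
rewrite (@sum_single _ _ a) => [|i ia].
  by rewrite aB singleE subrr normr0 ltW.
by rewrite /single /= dfwith_out 1?eq_sym// dot0l.
Qed.

Lemma norm_single a (v : H a) : `|single v| = `|v|.
Proof.
apply/eqP; rewrite -(@eqrXn2 _ 2)// -!dot_norm dot_single.
by rewrite singleE.
Qed.

(** [T] is the direct sum of the operators [x i]. *)
Definition diagonal (T : bop (ell2 H)) (x : forall i, bop (H i)) :=
  forall f i, T f i = x i (f i).

Lemma diagonal_star T x : diagonal T x -> diagonal (star T) (fun i => star (x i)).
Proof.
move=> Tx f i; apply: dot_extl => v.
rewrite dot_conj -dot_single -[star T]/(bop_star T) -bop_starE.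
have -> : T (single v) = single (x i v).
  apply: ell2_eq => j; rewrite Tx; have [->|ji] := eqVneq j i.
    by rewrite !singleE.
  by rewrite /single /= !dfwith_out 1?eq_sym// bop0.
by rewrite dot_single bop_starE -dot_conj.
Qed.

(** Test [T] on the vectors concentrated at [i]. *)
Lemma diagonal_norm_le T x i : diagonal T x -> `|x i| <= `|T|.
Proof.
move=> Tx; apply/bop_norm_leP => // v.
rewrite -[v in X in X <= _]singleE -Tx -(norm_single v).
exact: le_trans (ell2_coord_le _ _) (bopE_norm_le _ _).
Qed.
End Single.

(** * Minimal tensor products with a finite-dimensional algebra *)

Section AlgebraicTensor.
Variable R : realType.
Local Notation C := R[i].
Variables (A B S : cstarAlgType C) (b : A -> B -> S).
Hypothesis hb : tensor_compatible b.

Definition tensor_sum (s : seq (A * B)) : S := \sum_(q <- s) b q.1 q.2.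

Fact tensor_sumZD z s s' : exists r, z *: tensor_sum s + tensor_sum s' = tensor_sum r.
Proof.
have [[bl br] _ _ _] := hb.
exists ([seq (z *: q.1, q.2) | q <- s] ++ s').
rewrite /tensor_sum big_cat big_map scaler_sumr; congr (_ + _).
by apply: eq_bigr => q _; rewrite (linZ (br _)).
Qed.

Fact tensor_sumM s s' : exists r, (tensor_sum s * tensor_sum s')%g = tensor_sum r.
Proof.
have [_ bM _ _] := hb.
exists [seq ((q.1 * q'.1)%g, (q.2 * q'.2)%g) | q <- s, q' <- s'].
rewrite /tensor_sum cstar_mul_suml big_allpairs_dep.
apply: eq_bigr => q _; rewrite cstar_mul_sumr.
by apply: eq_bigr => q' _; rewrite bM.
Qed.

Fact tensor_sum_star s : exists r, star (tensor_sum s) = tensor_sum r.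
Proof.
have [_ _ _ bs] := hb; exists [seq (star q.1, star q.2) | q <- s].
by rewrite /tensor_sum star_sum big_map; apply: eq_bigr => q _; rewrite bs.
Qed.

Definition tensor_subalgebra : star_subalgebra S.
Proof.
refine (@Build_star_subalgebra C S [set x | exists s, x = tensor_sum s] _ _ _ _).
- by move=> z _ _ [s ->] [s' ->]; exact: tensor_sumZD.
- have [_ _ b1 _] := hb; exists [:: (1%g, 1%g)].
  by rewrite /tensor_sum big_seq1 b1.
- by move=> _ _ [s ->] [s' ->]; exact: tensor_sumM.
- by move=> _ [s ->]; exact: tensor_sum_star.
Defined.

Lemma tensor_subalgebra_mem a b' : subalg_set tensor_subalgebra (b a b').
Proof. by exists [:: (a, b')]; rewrite /tensor_sum big_seq1. Qed.
End AlgebraicTensor.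

Section ConcreteTensor.
Variables (R : realType).
Local Notation C := R[i].
Variables (X : cstarAlgType C) (n : nat) (e : 'I_n -> X) (p : X -> 'M[C]_n)
  (u : 'I_n -> C).
Hypothesis hp : regular_matrices e p u.

Lemma tens_compatible (E : cstarAlgType C) (K : hilbertType C) (r : E -> bop K) :
  star_hom r -> tensor_compatible (fun x y => tens (p x) (r y)).
Proof.
move=> hr; split=> [|a b a' b'||a b].
- split=> [a z x y|y z a b].
    by rewrite (star_homZD hr) tens_linearr.
  by rewrite (regular_linear hp) tens_linearl.
- by rewrite tensM -(regularM hp) (star_homM hr).
- by rewrite (regular1 hp) (star_hom1 hr) tens1.
- by rewrite star_tens (regular_star hp) (star_hom_star hr).
Qed.

Lemma concrete_min_tensor (E : cstarAlgType C) (L : hilbertType C) (r : E -> bop L) :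
  star_hom r -> (forall x, `|r x| = `|x|) ->
  exists (T : cstarAlgType C) (t : X -> E -> T)
         (s : T -> bop (ell2 (fun _ : 'I_n => L))),
    [/\ min_tensor t, star_hom s, injective s
      & forall a x, s (t a x) = tens (p a) (r x)].
Proof.
move=> hr rn; have hb := tens_compatible hr; have [[bl br] _ _ _] := hb.
pose T := csub (tensor_subalgebra hb).
pose t a x : T := csub_in (tensor_subalgebra_mem hb a x).
have hs := csub_val_star_hom (tensor_subalgebra hb).
exists T, t, (@csub_val _ _ _); split=> //; last exact: csub_val_inj.
have tE a x : csub_val (t a x) = tens (p a) (r x) by [].
split.
  split=> [a z x y|y z a b]; apply: csub_val_inj;
    by rewrite csub_addE csub_scaleE !tE ?bl ?br.
exists (ell2 (fun _ : 'I_n => cline R)), L, (ell2 (fun _ : 'I_n => L)).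
exists (@vec_tensor _ _ _), (fun a => bop_fun (regular_rep p a)),
  (fun x => bop_fun (r x)), (fun y : T => @bop_fun R _ (csub_val y)); split; split.
- exact: vec_tensor_hilbert.
- apply: faithful_rep_of_isometric; first exact: (regular_rep_star_hom hp).
  exact: (regular_rep_isometric hp).
- exact: faithful_rep_of_isometric.
- by apply: faithful_rep_of_isometric hs _ => x; rewrite csub_normE.
- by move=> a x h k; rewrite tE tens_vec_tensor.
apply/dense_normP => x d d0.
have /dense_normP/(_ x d d0)[y [s ys] xy] := csub_in_dense (S := tensor_subalgebra hb).
exists y => //; exists s; apply: csub_val_inj.
by rewrite (star_hom_sum hs) ys.
Qed.
End ConcreteTensor.

(** * Words in a family of generators *)

(** *-polynomials as mere syntax: only their values matter, so no identification is
    made between different expressions. *)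
Inductive word (C G : Type) :=
| Gen of G
| One
| Lin of C & word C G & word C G
| Mul of word C G & word C G
| Star of word C G.
Arguments One {C G}.
Arguments Gen {C G}.

Section Words.
Variables (R : realType) (G : Type).
Local Notation C := R[i].
Local Notation word := (word C G).

Fixpoint eval (A : cstarAlgType C) (v : G -> A) (q : word) : A :=
  match q with
  | Gen g => v g
  | One => 1%g
  | Lin z q q' => z *: eval v q + eval v q'
  | Mul q q' => (eval v q * eval v q')%g
  | Star q => star (eval v q)
  end.

Lemma eval_star_hom (A B : cstarAlgType C) (f : A -> B) (v : G -> A) q :
  star_hom f -> f (eval v q) = eval (f \o v) q.
Proof.
move=> hf; elim: q => [g||z q IH q' IH'|q IH q' IH'|q IH] //=.
- exact: star_hom1.
- by rewrite (star_homZD hf) IH IH'.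
- by rewrite (star_homM hf) IH IH'.
- by rewrite (star_hom_star hf) IH.
Qed.

Definition word_subalgebra (A : cstarAlgType C) (v : G -> A) : star_subalgebra A.
Proof.
refine (@Build_star_subalgebra C A [set x | exists q, x = eval v q] _ _ _ _).
- by move=> z _ _ [q ->] [q' ->]; exists (Lin z q q').
- by exists One.
- by move=> _ _ [q ->] [q' ->]; exists (Mul q q').
- by move=> _ [q ->]; exists (Star q).
Defined.

Definition generates (A : cstarAlgType C) (v : G -> A) :=
  forall x : A, exists q : nat -> word, cvg_seq (fun k => eval v (q k)) x.

Lemma star_hom_ext (A B : cstarAlgType C) (v : G -> A) (f f' : A -> B) :
  generates v -> star_hom f -> star_hom f' -> (forall g, f (v g) = f' (v g)) ->
  f = f'.
Proof.
move=> gv hf hf' ff'; apply/funext => x; have [q qx] := gv x.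
have cvg_hom (h : A -> B) : star_hom h -> cvg_seq (fun k => eval (h \o v) (q k)) (h x).
  move=> hh; apply: (cvg_seq_dominated ler01 _ qx) => k.
  by rewrite mul1r -eval_star_hom// -(star_homB hh) star_hom_contractive.
apply: cvg_seq_unique (cvg_hom _ hf) _.
have -> : f \o v = f' \o v by apply/funext => g; exact: ff'.
exact: cvg_hom.
Qed.

(** The map [v g |-> w g] extends by continuity as soon as every word is at least
    as large in [A] as in [B]. *)
Lemma star_hom_of_dominated (A B : cstarAlgType C) (v : G -> A) (w : G -> B) :
  generates v -> (forall q, `|eval w q| <= `|eval v q|) ->
  exists f : A -> B, star_hom f /\ forall g, f (v g) = w g.
Proof.
move=> gv wv.
have wvB q q' : `|eval w q - eval w q'| <= 1 * `|eval v q - eval v q'|.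
  have := wv (Lin (-1) q' q); rewrite /= !scaleN1r mul1r.
  by rewrite ![- _ + _]addrC.
have /choice[f fP] : forall x, exists y, forall q : nat -> word,
    cvg_seq (fun k => eval v (q k)) x -> cvg_seq (fun k => eval w (q k)) y.
  move=> x; have [q qx] := gv x.
  have /cauchy_seq_cvg[y qy] : cauchy_seq (fun k => eval w (q k)).
    by apply: (cauchy_seq_sub ler01 _ (cvg_seq_cauchy qx)) => m k; exact: wvB.
  exists y => q' q'x d d0; have d2 : 0 < d / 2 by rewrite divr_gt0.
  have d4 : 0 < d / 2 / 2 by rewrite divr_gt0.
  have [N1 h1] := qx _ d4; have [N2 h2] := q'x _ d4; have [N3 h3] := qy _ d2.
  exists (maxn N1 (maxn N2 N3)) => k; rewrite !geq_max => /and3P[k1 k2 k3].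
  rewrite -(subrKA (eval w (q k))) (splitr d); apply: le_trans (ler_normD _ _) _.
  rewrite lerD ?h3//; apply: le_trans (wvB _ _) _; rewrite mul1r.
  rewrite -(subrKA x) (splitr (d / 2)); apply: le_trans (ler_normD _ _) _.
  by rewrite lerD ?h2// distrC h1.
have fv q : f (eval v q) = eval w q.
  apply: (@cvg_seq_unique _ _ (fun=> eval w q)); last exact: cvg_seq_cst.
  by apply: (fP _ (fun=> q)); exact: cvg_seq_cst.
have fl : linear f.
  move=> z x y; have [q qx] := gv x; have [q' qy] := gv y.
  apply: (@cvg_seq_unique _ _ (fun k => eval w (Lin z (q k) (q' k)))).
    by apply: fP; apply: cvg_seqZD.
  by apply: cvg_seqZD; exact: fP.
have f_le x : `|f x| <= 1 * `|x|.
  rewrite mul1r; apply/ler_addgt0Pr => d d0; have d2 : 0 < d / 2 by rewrite divr_gt0.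
  have [q qx] := gv x; have [N hN] := qx _ d2; have [M hM] := fP _ _ qx _ d2.
  pose k := maxn N M; rewrite -(subrK (eval w (q k)) (f x)).
  have -> : `|x| + d = d / 2 + (`|x| + d / 2) by field.
  apply: le_trans (ler_normD _ _) _.
  rewrite lerD//; first by rewrite distrC hM ?leq_maxr.
  apply: le_trans (wv _) _; rewrite -(subrK x (eval v (q k))) addrC.
  by apply: le_trans (ler_normD _ _) _; rewrite lerD// hN ?leq_maxl.
have f_cvg (x : nat -> A) y : cvg_seq x y -> cvg_seq (fun k => f (x k)) (f y).
  apply: (cvg_seq_dominated ler01) => k.
  by rewrite -(linB fl) f_le.
exists f; split=> [|g]; last exact: (fv (Gen g)).
split=> // [x y||x].
- have fMw a q : f (a * eval v q)%g = (f a * eval w q)%g.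
    have [q' q'a] := gv a.
    apply: (@cvg_seq_unique _ _ (fun k => eval w (Mul (q' k) q))).
      by apply: fP; exact: cvg_seqMr.
    by apply: cvg_seqMr; exact: fP.
  have [q qy] := gv y.
  apply: (@cvg_seq_unique _ _ (fun k => f (x * eval v (q k))%g)).
    by apply: f_cvg; exact: cvg_seqMl.
  under eq_fun do rewrite fMw.
  by apply: cvg_seqMl; exact: fP.
- exact: (fv One).
have [q qx] := gv x.
apply: (@cvg_seq_unique _ _ (fun k => eval w (Star (q k)))).
  by apply: fP; exact: cvg_seq_star.
by apply: cvg_seq_star; exact: fP.
Qed.
End Words.

(** * Quantum families of maps on Hilbert spaces *)

HB.instance Definition _ (C G : Type) := gen_eqMixin (word C G).
HB.instance Definition _ (C G : Type) := gen_choiceMixin (word C G).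

Section Systems.
Variables (R : realType).
Local Notation C := R[i].
Variables (X Y : cstarAlgType C) (n : nat) (e : 'I_n -> X) (p : X -> 'M[C]_n)
  (u : 'I_n -> C).
Hypothesis hp : regular_matrices e p u.
Local Notation word := (word C ('I_n * Y)).

Definition assemble (K : hilbertType C) (psi : 'I_n * Y -> bop K) (y : Y) :=
  \sum_i tens (p (e i)) (psi (i, y)).

(** A quantum family of maps parametrized by an algebra of operators on [K],
    given by its coordinates in the basis [e]. *)
Definition operator_family (K : hilbertType C) (psi : 'I_n * Y -> bop K) :=
  star_hom (assemble psi).

(** Applied to [u (x) k], the assembled operator yields the vector with components
    [psi (i, y) k], because [p (e m) u] is the [m]-th basis vector; it is contractive
    in [y]. *)
Lemma operator_family_bound K (psi : 'I_n * Y -> bop K) i y :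
  operator_family psi ->
  `|psi (i, y)| <= `|vec (u : 'I_n -> cline R)| * `|y|.
Proof.
move=> hpsi; apply/bop_norm_leP => [|k]; first by rewrite mulr_ge0.
pose uk := vec_tensor (vec (u : 'I_n -> cline R)) k.
have -> : psi (i, y) k = assemble psi y uk i.
  rewrite bop_sumE ell2_sumE.
  under eq_bigr => m _ do rewrite tensE.
  transitivity (\sum_m (\sum_j p (e m) i j * u j) *: psi (m, y) k).
    rewrite (bigD1 i)//= (regular_basis hp) eqxx scale1r big1 ?addr0// => m mi.
    by rewrite (regular_basis hp) eq_sym (negPf mi) scale0r.
  apply: eq_bigr => m _; rewrite scaler_suml; apply: eq_bigr => j _.
  by rewrite /uk vecE bopZ scalerA.
apply: le_trans (ell2_coord_le _ _) _; apply: le_trans (bopE_norm_le _ _) _.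
rewrite (norm_hilbert_tensor (@vec_tensor_hilbert R n K)) mulrA ler_wpM2r//.
by rewrite mulrC ler_wpM2l// star_hom_contractive.
Qed.

Section DirectSum.
Variables (I : choiceType) (K : I -> hilbertType C)
  (psi : forall a, 'I_n * Y -> bop (K a)).
Hypothesis hpsi : forall a, operator_family (psi a).

(** The bound is the same for all families, which makes the direct sum possible. *)
Fact sum_family_bounded g : uniformly_bounded (fun a => psi a g).
Proof.
exists (`|vec (u : 'I_n -> cline R)| * `|g.2|) => a; case: g => i y.
exact: operator_family_bound.
Qed.

Definition sum_family g : bop (ell2 K) := bdiag (sum_family_bounded g).

Let slice (f : ell2 (fun _ : 'I_n => ell2 K)) a := vec (fun j => f j a).

Lemma sum_tens_bdiagE (M : 'I_n -> 'M[C]_n) (x : 'I_n -> forall a, bop (K a))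
    (xb : forall i, uniformly_bounded (x i)) f m a :
  (\sum_i tens (M i) (bdiag (xb i))) f m a =
  (\sum_i tens (M i) (x i a)) (slice f a) m.
Proof.
rewrite !bop_sumE !ell2_sumE; apply: eq_bigr => i _; exact: tens_bdiagE.
Qed.

Lemma assemble_sumE y f m a :
  assemble sum_family y f m a = assemble (psi a) y (slice f a) m.
Proof. exact: sum_tens_bdiagE. Qed.

(** The relations are checked in each summand. *)
Lemma sum_operator_family : operator_family sum_family.
Proof.
split=> [z y y'|y y'||y]; apply: bop_eq => f; apply: ell2_eq => m; apply: ell2_eq => a.
- rewrite bop_addE bop_scaleE (ell2_addE _ _ m) (ell2_addE _ _ a).
  rewrite (ell2_scaleE _ _ m) (ell2_scaleE _ _ a) !assemble_sumE.
  by rewrite (star_homZD (hpsi a)) bop_addE bop_scaleE ell2_addE ell2_scaleE.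
- rewrite bop_mulE !assemble_sumE (star_homM (hpsi a)) bop_mulE.
  congr (ell2_fun (bop_fun _ _) m); apply: ell2_eq => j.
  by rewrite [RHS]assemble_sumE.
- by rewrite assemble_sumE (star_hom1 (hpsi a)).
rewrite assemble_sumE (star_hom_star (hpsi a)) star_sum [in RHS]star_sum.
under eq_bigr do rewrite star_tens.
under [in RHS]eq_bigr do rewrite star_tens star_bdiag.
by rewrite sum_tens_bdiagE.
Qed.

Lemma eval_sum_family q : diagonal (eval sum_family q) (fun a => eval (psi a) q).
Proof.
elim: q => [g||z q IH q' IH'|q IH q' IH'|q IH] //=.
- by move=> f a; rewrite bop_addE bop_scaleE ell2_addE ell2_scaleE IH IH'.
- by move=> f a; rewrite bop_mulE IH IH'.
- exact: diagonal_star.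
Qed.
End DirectSum.

Let bad_family (j : word * C) (s : {K : hilbertType C & 'I_n * Y -> bop K}) :=
  operator_family (projT2 s) /\ ~ (`|eval (projT2 s) j.1| <= j.2).

(** A direct sum of operator families indexed by the words [q] and the bounds [r]
    that some family violates: a set of families large enough to dominate all
    families. *)
Lemma universal_operator_family :
  exists (L : hilbertType C) (Psi : 'I_n * Y -> bop L),
    operator_family Psi /\
    forall (K : hilbertType C) (psi : 'I_n * Y -> bop K),
      operator_family psi -> forall q, `|eval psi q| <= `|eval Psi q|.
Proof.
pose J := {j : word * C | `[< exists s, bad_family j s >]}.
have Jbad (j : J) : exists s, bad_family (val j) s by apply/asboolP; exact: (valP j).
pose fam (j : J) := projT1 (cid (Jbad j)).
have famP (j : J) : bad_family (val j) (fam j) := projT2 (cid (Jbad j)).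
have hpsi (j : J) : operator_family (projT2 (fam j)) := (famP j).1.
exists (ell2 (fun j : J => projT1 (fam j))), (sum_family hpsi).
split; first exact: sum_operator_family.
move=> K psi psiP q; apply: contrapT => bad.
have ex : `[< exists s, bad_family (q, `|eval (sum_family hpsi) q|) s >].
  by apply/asboolP; exists (existT _ K psi).
pose j : J := Sub (q, `|eval (sum_family hpsi) q|) ex.
(* The family selected for [(q, r)] is a summand of [Psi], hence bounded by [r] at [q]. *)
apply: (famP j).2.
exact: (@diagonal_norm_le _ _ _ _ _ j (eval_sum_family hpsi q)).
Qed.

End Systems.

Theorem theoremI5p2 (R : realType) (X Y : cstarAlgType R[i]) :
  finite_dimensional X -> finitely_generated Y ->
  exists (E T : cstarAlgType R[i]) (t : X -> E -> T) (Phi : Y -> T),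
    quantum_family_of_all_maps t Phi.
Proof.
move=> Xfin _.
have [n [e [p [u hp]]]] := regular_matrices_exist Xfin.
have [L [Psi [PsiP Psi_max]]] := universal_operator_family Y hp.
pose E : cstarAlgType R[i] := csub (word_subalgebra Psi).
pose v (g : 'I_n * Y) : E :=
  csub_in (ex_intro _ (Gen g) erefl : subalg_set (word_subalgebra Psi) (Psi g)).
have hr : star_hom (@csub_val _ _ _ : E -> bop L) := csub_val_star_hom _.
have evE q : csub_val (eval v q) = eval Psi q by rewrite (eval_star_hom _ _ hr).
have vgen : generates v.
  move=> x; have [a [aS ax]] := closure_seq (csubP x).
  have /choice[q hq] : forall k, exists q, a k = eval Psi q by [].
  exists q; apply: (cvg_seq_dominated ler01 _ ax) => k.
  by rewrite mul1r csub_normE csub_subE evE hq.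
(* The inclusion of [E] into the operators on [L] is isometric by construction. *)
have [T [t [s [ht hs s_inj sE]]]] := concrete_min_tensor hp hr (fun x => erefl).
have [[tl tr] tM t1 tstar] := min_tensor_compatible ht.
pose Phi y := \sum_i t (e i) (v (i, y)).
have sPhi y : s (Phi y) = assemble e p Psi y.
  by rewrite (star_hom_sum hs); apply: eq_bigr => i _; rewrite sE.
exists E, T, t, Phi; split=> //.
  split=> [z y y'|y y'||y]; apply: s_inj.
  - by rewrite (star_homZD hs) !sPhi (star_homZD PsiP).
  - by rewrite (star_homM hs) !sPhi (star_homM PsiP).
  - by rewrite (star_hom1 hs) sPhi (star_hom1 PsiP).
  - by rewrite (star_hom_star hs) !sPhi (star_hom_star PsiP).
move=> D S t' Psi' ht' hPsi'.
have [[tl' tr'] tM' t1' tstar'] := min_tensor_compatible ht'.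
pose d (g : 'I_n * Y) := coef hp ht' (Psi' g.2) g.1.
have dE y : Psi' y = \sum_i t' (e i) (d (i, y)) by exact: coefE.
(* Represented on a Hilbert space, the coordinates of [Psi'] are an operator family,
   since [S] maps to operators by [t' a b |-> tens (p a) (g b)]. *)
have d_dominated q : `|eval d q| <= `|eval v q|.
  have [tb [H [K [L' [th [pi [rho [sigma [[_ _ /faithful_rep_bop[g [hg gn _]] _] _]]]]]]]]] := ht'.
  rewrite -gn (eval_star_hom _ _ hg) csub_normE evE; apply: Psi_max.
  have [m [hm mE]] := tensor_extension hp ht' (tens_compatible hp hg).
  have mPsi' y : assemble e p (g \o d) y = m (Psi' y).
    by rewrite dE (star_hom_sum hm); apply: eq_bigr => i _; rewrite mE.
  split=> [z y y'|y y'||y]; rewrite !mPsi'.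
  - by rewrite (star_homZD hPsi') (star_homZD hm).
  - by rewrite (star_homM hPsi') (star_homM hm).
  - by rewrite (star_hom1 hPsi') (star_hom1 hm).
  - by rewrite (star_hom_star hPsi') (star_hom_star hm).
have [Lambda [hL LE]] := star_hom_of_dominated vgen d_dominated.
exists Lambda; split.
  split=> //.
  have hb : tensor_compatible (fun a x => t' a (Lambda x)).
    split=> [|a x a' x'||a x].
    - by split=> [a z x x'|x]; [rewrite (star_homZD hL) tl' | exact: tr'].
    - by rewrite tM' (star_homM hL).
    - by rewrite (star_hom1 hL).
    - by rewrite tstar' (star_hom_star hL).
  have [m [hm mE]] := tensor_extension hp ht hb.
  exists m; split; first by split.
  apply/funext => y; rewrite /= (star_hom_sum hm) dE.
  by apply: eq_bigr => i _; rewrite mE LE.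
move=> Lambda' [hL' [m [[hm mE] Psi'E]]].
apply: (star_hom_ext vgen hL hL') => -[i y]; rewrite LE.
apply: (coef_unique hp ht' (d := fun i => d (i, y))
  (d' := fun i => Lambda' (v (i, y)))); rewrite -dE Psi'E /= (star_hom_sum hm).
by apply: eq_bigr => j _; rewrite mE.
Qed.
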